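(* Let $f:\mathbb{R}^n\times\mathbb{R}_+\to\mathbb{R}$ be such that $f(\cdot;t)$ is $m$-strongly convex and $L$-smooth for every $t\ge 0$, with constants $0<m\le L$ independent of $t$; let $g:\mathbb{R}^n\to\mathbb{R}\cup\{+\infty\}$ be closed, convex and proper (possibly nonsmooth); and let $\|\nabla_{t\mathbf{x}}f(\mathbf{x};t)\|\le C_0$ for all $(\mathbf{x},t)$. Fix a sampling period $T_{\mathrm{s}}>0$, sampling times $t_k$ with $t_{k+1}-t_k=T_{\mathrm{s}}$, and let $\mathbf{x}_k^*=\arg\min_{\mathbf{x}\in\mathbb{R}^n}\{f(\mathbf{x};t_k)+g(\mathbf{x})\}$. Run the prediction-correction algorithm described in the context with a splitting method (forward-backward or Douglas-Rachford), step-size $\rho$ and numbers of steps $P$ and $C$ such that $$\eta:=\zeta(C)\left[\zeta(P)+(\zeta(P)+1)\frac{2L}{m}\right]<1,$$ from an arbitrary initial point $\mathbf{x}_0\in\mathbb{R}^n$, where $\zeta(k)=\zeta_{\mathrm{FB}}^k$ if forward-backward splitting is used and $\zeta(k)=\zeta_{\mathrm{DR}}^k\frac{1+\rho L}{1+\rho m}$ if Douglas-Rachford splitting is used. Then the generated sequence $\{\mathbf{x}_k\}_{k\in\mathbb{N}}$ converges Q-linearly to a neighborhood of the optimal trajectory $\{\mathbf{x}_k^*\}_{k\in\mathbb{N}}$, and in particular $$\limsup_{k\to\infty}\|\mathbf{x}_k-\mathbf{x}_k^*\|=O(\zeta(C)\,T_{\mathrm{s}}).$$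
   Context: Norms are Euclidean (and induced). A function $\varphi:\mathbb{R}^n\to\mathbb{R}$ is $m$-strongly convex if $\varphi-\frac m2\|\cdot\|^2$ is convex, and $L$-smooth if its gradient is $L$-Lipschitz. A function is proper if it never takes the value $-\infty$ and is not identically $+\infty$. $\nabla_{\mathbf{x}}f$, $\nabla_{\mathbf{x}\mathbf{x}}f$ are the gradient and Hessian in $\mathbf{x}$, and $\nabla_{t\mathbf{x}}f$ is the time derivative of $\nabla_{\mathbf{x}}f$; $f$ is assumed to be regular enough that these exist and are continuous. For closed, convex, proper $\gamma$ and $\rho>0$, $\operatorname{prox}_{\rho\gamma}(\mathbf{x})=\arg\min_{\mathbf{y}}\{\gamma(\mathbf{y})+\frac1{2\rho}\|\mathbf{y}-\mathbf{x}\|^2\}$. Splitting methods for $\min_{\mathbf{x}}\{\varphi(\mathbf{x})+\gamma(\mathbf{x})\}$, with $\varphi$ $m$-strongly convex and $L$-smooth and $\gamma$ closed, convex, proper: - Forward-backward splitting (FBS), $0<\rho<2/L$: $\mathbf{x}(j+1)=\operatorname{prox}_{\rho\gamma}(\mathbf{x}(j)-\rho\nabla\varphi(\mathbf{x}(j)))$. Put $\zeta_{\mathrm{FB}}=\max\{|1-\rho m|,|1-\rho L|\}$. - Douglas-Rachford splitting (DRS), $\rho>0$: $\mathbf{x}(j)=\operatorname{prox}_{\rho\varphi}(\mathbf{z}(j))$, $\mathbf{y}(j)=\operatorname{prox}_{\rho\gamma}(2\mathbf{x}(j)-\mathbf{z}(j))$, $\mathbf{z}(j+1)=\mathbf{z}(j)+\mathbf{y}(j)-\mathbf{x}(j)$.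 Put $\zeta_{\mathrm{DR}}=\max\{\frac1{1+\rho m},\frac{\rho L}{1+\rho L}\}$. ''Performing $J$ steps of the splitting with initial condition $\bar{\mathbf{x}}$'' means producing $\mathbf{x}(J)$ from $\mathbf{x}(0)=\bar{\mathbf{x}}$; for DRS, $\mathbf{z}(0)$ is chosen so that $\operatorname{prox}_{\rho\varphi}(\mathbf{z}(0))=\bar{\mathbf{x}}$, i.e. $\mathbf{z}(0)=\bar{\mathbf{x}}+\rho\nabla\varphi(\bar{\mathbf{x}})$. Prediction-correction algorithm. Inputs: $\mathbf{x}_0$, step-size $\rho$, numbers of steps $P,C\in\mathbb{N}$, and a choice of FBS or DRS. For $k=0,1,\dots$: (prediction, at time $t_k$) let $h_k$ be the quadratic function with gradient $$\nabla h_k(\mathbf{x})=\nabla_{\mathbf{x}}f(\mathbf{x}_k;t_k)+\nabla_{\mathbf{x}\mathbf{x}}f(\mathbf{x}_k;t_k)(\mathbf{x}-\mathbf{x}_k)+T_{\mathrm{s}}\nabla_{t\mathbf{x}}f(\mathbf{x}_k;t_k),$$ and let $\tilde{\mathbf{x}}_{k+1|k}$ be the result of $P$ steps of the splitting with $\varphi=h_k$, $\gamma=g$ and initial condition $\mathbf{x}_k$; (correction, at time $t_{k+1}$) let $\mathbf{x}_{k+1}$ be the result of $C$ steps of the splitting with $\varphi=f(\cdot;t_{k+1})$, $\gamma=g$ and initial condition $\tilde{\mathbf{x}}_{k+1|k}$. ''Converges Q-linearly to a neighborhood'' means that there are $q\in[0,1)$ and $r\ge 0$, independent of $k$, with $\|\mathbf{x}_{k+1}-\mathbf{x}_{k+1}^*\|\le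 q\|\mathbf{x}_k-\mathbf{x}_k^*\|+r$ for all $k$. The notation $O(\zeta(C)T_{\mathrm{s}})$ means bounded by $K\zeta(C)T_{\mathrm{s}}$, where $K$ depends only on $m,L,C_0$ and $\eta$ (in particular not on $T_{\mathrm{s}}$ or $\mathbf{x}_0$). *)

(* Defs.v *)
From HB Require Import structures.
From mathcomp Require Import all_boot all_order all_algebra.
From mathcomp Require Import all_classical all_reals all_analysis.
From mathcomp Require Import ring.
Set Implicit Arguments.
Unset Strict Implicit.
Unset Printing Implicit Defensive.
Import Order.TTheory GRing.Theory Num.Theory.
Import numFieldNormedType.Exports.
Local Open Scope classical_set_scope.
Local Open Scope ring_scope.

(* The vectors of R^n are the row vectors 'rV[R]_n.  The norm that the library
   puts on them is the sup norm; it is used only for the topology and for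
   differentiability, which do not depend on the choice of the norm.  All the
   quantitative statements use the Euclidean norm enorm. *)

Section Euclidean.
Context {R : realType} {n : nat}.
Implicit Types (x y : 'rV[R]_n) (phi : 'rV[R]_n -> R) (gam : 'rV[R]_n -> \bar R).

Definition dot x y : R := \sum_(i < n) x 0 i * y 0 i.

Definition enorm x : R := Num.sqrt (dot x x).

Definition gradient phi x : 'rV[R]_n :=
  \row_(i < n) 'D_(delta_mx 0 i) (phi : 'rV[R]_n -> R^o) x.

(* The matrix of the differential of the gradient, acting on row vectors from
   the right: the directional derivative of the gradient along v is
   v *m hessian phi x. *)
Definition hessian phi x : 'M[R]_n := 'J (gradient phi) x.

Definition strongly_convex (m : R) phi :=
  convex_function setT (fun x => phi x - m / 2 * enorm x ^+ 2).

Definition L_smooth (L : R) phi :=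
  (forall x, differentiable (phi : 'rV[R]_n -> R^o) x) /\
  (forall x y, enorm (gradient phi x - gradient phi y) <= L * enorm (x - y)).

Definition eproper gam :=
  (forall x, gam x != -oo%E) /\ (exists x, gam x != +oo%E).

(* 0%:E * +oo = 0 in \bar R, so a = 0 and a = 1 impose nothing. *)
Definition econvex gam :=
  forall x y (a : R), 0 <= a <= 1 ->
    (gam (a *: x + (1 - a) *: y)%R
       <= a%:E * gam x + (1 - a)%:E * gam y)%E.

Definition eclosed gam :=
  closed [set p : 'rV[R]_n * R | (gam p.1 <= p.2%:E)%E].

(* An arbitrary vector when F has no minimizer; all the functions F considered
   below have exactly one. *)
Definition argmin (F : 'rV[R]_n -> \bar R) : 'rV[R]_n :=
  [get x | forall y, (F x <= F y)%E].

Definition prox (rho : R) gam x : 'rV[R]_n :=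
  argmin (fun y => gam y + ((2 * rho)^-1 * enorm (y - x) ^+ 2)%:E)%E.

End Euclidean.

Inductive splitting := FBS | DRS.

Section Splitting.
Context {R : realType} {n : nat}.
Implicit Types (s : splitting) (rho m L : R).
Implicit Types (phi : 'rV[R]_n -> R) (gam : 'rV[R]_n -> \bar R).

Definition step_size_ok s L rho : Prop :=
  match s with
  | FBS => 0 < rho < 2 / L
  | DRS => 0 < rho
  end.

Definition zetaFB m L rho : R := Num.max `|1 - rho * m| `|1 - rho * L|.

Definition zetaDR m L rho : R :=
  Num.max (1 / (1 + rho * m)) (rho * L / (1 + rho * L)).

Definition zeta s m L rho (k : nat) : R :=
  match s with
  | FBS => zetaFB m L rho ^+ k
  | DRS => zetaDR m L rho ^+ k * ((1 + rho * L) / (1 + rho * m))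
  end.

Definition fb_step rho phi gam (x : 'rV[R]_n) : 'rV[R]_n :=
  prox rho gam (x - rho *: gradient phi x).

Definition dr_step rho phi gam (z : 'rV[R]_n) : 'rV[R]_n :=
  let x := prox rho (EFin \o phi) z in
  let y := prox rho gam (2 *: x - z) in
  z + y - x.

(* xbar + rho *: gradient phi xbar is the point whose proximal point with
   respect to phi is xbar. *)
Definition splitting_steps s rho phi gam (J : nat) (xbar : 'rV[R]_n)
    : 'rV[R]_n :=
  match s with
  | FBS => iter J (fb_step rho phi gam) xbar
  | DRS => prox rho (EFin \o phi)
             (iter J (dr_step rho phi gam) (xbar + rho *: gradient phi xbar))
  end.

End Splitting.

Section PredictionCorrection.
Context {R : realType} {n : nat}.
Implicit Types (f : 'rV[R]_n -> R -> R) (g : 'rV[R]_n -> \bar R).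

(* The time variable ranges over R_+, so the values of f at negative times are
   irrelevant; the time derivative is one-sided at t = 0. *)
Definition grad_quotient f (x : 'rV[R]_n) (t s : R) : 'rV[R]_n :=
  (s - t)^-1 *: (gradient (f^~ s) x - gradient (f^~ t) x).

Definition time_nbhs (t : R) : set_system R := within [set s | 0 <= s] t^'.

Definition dt_gradient f x t : 'rV[R]_n :=
  lim (grad_quotient f x t @ time_nbhs t).

Definition regular_cost f :=
  [/\ forall x t, 0 <= t -> differentiable (f^~ t : 'rV[R]_n -> R^o) x,
      forall x t, 0 <= t -> differentiable (gradient (f^~ t)) x
    & forall x t, 0 <= t -> cvg (grad_quotient f x t @ time_nbhs t)] /\
  (let D := [set p : 'rV[R]_n * R | 0 <= p.2] in
   [/\ {within D, continuous (fun p => gradient (f^~ p.2) p.1)},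
       {within D, continuous (fun p => hessian (f^~ p.2) p.1)}
     & {within D, continuous (fun p => dt_gradient f p.1 p.2)}]).

Definition quadratic (b : 'rV[R]_n) (H : 'M[R]_n) (x0 x : 'rV[R]_n) : R :=
  dot b (x - x0) + 2^-1 * dot ((x - x0) *m H) (x - x0).

(* Fixed up to an additive constant, which affects neither gradients nor
   proximal operators.  By gradient_quadratic below, its gradient at x is
   grad f (x_k; t) + (x - x_k) *m hess f (x_k; t) + Ts * d/dt grad f (x_k; t),
   the Hessian being symmetric by continuity. *)
Definition prediction_model f (Ts t : R) (xk : 'rV[R]_n) : 'rV[R]_n -> R :=
  quadratic (gradient (f^~ t) xk + Ts *: dt_gradient f xk t)
            (hessian (f^~ t) xk) xk.

Fixpoint pc_sequence (s : splitting) (rho : R) (P C : nat) f g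
    (Ts : R) (t : nat -> R) (x0 : 'rV[R]_n) (k : nat) : 'rV[R]_n :=
  match k with
  | 0 => x0
  | k'.+1 =>
      let xk := pc_sequence s rho P C f g Ts t x0 k' in
      let xpred :=
        splitting_steps s rho (prediction_model f Ts (t k') xk) g P xk in
      splitting_steps s rho (f^~ (t k'.+1)) g C xpred
  end.

Definition optimal_trajectory f g (t : nat -> R) (k : nat) : 'rV[R]_n :=
  argmin (fun x => (f x (t k))%:E + g x)%E.

Definition Qlinear_to_neighborhood (x xstar : nat -> 'rV[R]_n) :=
  exists q r : R, [/\ 0 <= q, q < 1, 0 <= r &
    forall k, enorm (x k.+1 - xstar k.+1) <= q * enorm (x k - xstar k) + r].

End PredictionCorrection.

Section GradientQuadratic.
Context {R : realType} {n : nat}.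

Lemma dot_mx (x y : 'rV[R]_n) : dot x y = (x *m y^T) 0 0.
Proof. by rewrite mxE; apply: eq_bigr => i _; rewrite mxE. Qed.

Lemma gradient_quadratic (b : 'rV[R]_n) (H : 'M[R]_n) (x0 x : 'rV[R]_n) :
  H^T = H -> gradient (quadratic b H x0) x = b + (x - x0) *m H.
Proof.
move=> Hsym.
have dotC (u v : 'rV[R]_n) : dot u v = dot v u.
  by apply: eq_bigr => i _; rewrite mulrC.
have dotDl (u v w : 'rV[R]_n) : dot (u + v) w = dot u w + dot v w.
  by rewrite !dot_mx mulmxDl mxE.
have dotDr (u v w : 'rV[R]_n) : dot w (u + v) = dot w u + dot w v.
  by rewrite dotC dotDl !(dotC w).
have dotZl a (u w : 'rV[R]_n) : dot (a *: u) w = a * dot u w.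
  by rewrite !dot_mx -scalemxAl mxE.
have dotZr a (u w : 'rV[R]_n) : dot w (a *: u) = a * dot w u.
  by rewrite dotC dotZl dotC.
have symH (u v : 'rV[R]_n) : dot (u *m H) v = dot (v *m H) u.
  by rewrite [RHS]dotC !dot_mx trmx_mul Hsym mulmxA.
apply/rowP => i; rewrite mxE.
set e : 'rV[R]_n := delta_mx 0 i.
have [d dE] : exists d, d = x - x0 by exists (x - x0).
have dotE (u : 'rV[R]_n) : dot u e = u 0 i.
  rewrite /dot (bigD1 i)//= big1 ?addr0 => [|j ji].
    by rewrite /e mxE !eqxx mulr1.
  by rewrite /e mxE (negbTE ji) andbF mulr0.
rewrite -dotE dotDl -dE.
apply: cvg_lim => //.
pose B := 2^-1 * dot (e *m H) e.
have cv : (fun h : R => dot b e + dot (d *m H) e + h * B) @ 0^' -->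
    dot b e + dot (d *m H) e + 0 * B.
  apply: cvgD; first exact: cvg_cst.
  by apply: cvgMr_tmp; exact: nbhs_dnbhs.
rewrite mul0r addr0 in cv.
apply: cvg_trans cv; apply: near_eq_cvg; near=> h.
have h0 : h != 0 by near: h; exact: nbhs_dnbhs_neq.
rewrite /quadratic /= -dE.
have -> : h *: e + x - x0 = h *: e + d by rewrite dE addrA.
rewrite mulmxDl -scalemxAl !dotDr !dotDl !dotZr !dotZl (symH e d).
rewrite /GRing.scale/= /B.
by field.
Unshelve. all: by end_near.
Qed.

End GradientQuadratic.

(* Main.v *)
Require Import Defs.
From HB Require Import structures.
From mathcomp Require Import all_boot all_order all_algebra.
From mathcomp Require Import all_classical all_reals all_analysis.
From mathcomp Require Import ring lra.
Set Implicit Arguments.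
Unset Strict Implicit.
Unset Printing Implicit Defensive.
Import Order.TTheory GRing.Theory Num.Theory.
Import numFieldNormedType.Exports.
Local Open Scope classical_set_scope.
Local Open Scope ring_scope.

(* Write d = x - y and u = grad phi x - grad phi y.  For phi m-strongly convex
   and L-smooth, Baillon-Haddad applied to phi - m/2 |.|^2 gives the sector
   inequality <u - m d, L d - u> >= 0: it says that u lies in the ball with
   diameter [m d, L d], which yields the contraction factors of the forward step
   x - rho grad phi x and of the reflected resolvent of phi.  Combined with the
   nonexpansiveness of the (reflected) proximal operator of g, J steps of either
   splitting contract the distance to the minimizer by zeta(J).  As minimizers
   are 1/m-Lipschitz in perturbations of the gradient, the optimum drifts by at
   most C0 Ts / m per period, and the minimizer of the prediction model is within
   (2 L / m) |x_k - x*_{k+1}| + 2 C0 Ts / m of x*_{k+1}.  The triangle inequality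
   then gives e_{k+1} <= eta e_k + O(zeta(C) Ts), where zeta(P) <= L / m makes the
   constant independent of rho, P and C. *)

(** * Euclidean inner product and norm on row vectors *)

Section InnerProduct.
Context {R : realType} {n : nat}.
Implicit Types (u v w x y : 'rV[R]_n) (a : R).

Lemma dotC x y : dot x y = dot y x.
Proof. by apply: eq_bigr => i _; rewrite mulrC. Qed.

Lemma dotDl x y w : dot (x + y) w = dot x w + dot y w.
Proof. by rewrite !dot_mx mulmxDl mxE. Qed.

Lemma dotZl a x w : dot (a *: x) w = a * dot x w.
Proof. by rewrite !dot_mx -scalemxAl mxE. Qed.

Lemma dotNl x w : dot (- x) w = - dot x w.
Proof. by rewrite -scaleN1r dotZl mulN1r. Qed.

Lemma dotBl x y w : dot (x - y) w = dot x w - dot y w.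
Proof. by rewrite dotDl dotNl. Qed.

Lemma dotDr x y w : dot w (x + y) = dot w x + dot w y.
Proof. by rewrite dotC dotDl !(dotC w). Qed.

Lemma dotZr a x w : dot w (a *: x) = a * dot w x.
Proof. by rewrite dotC dotZl dotC. Qed.

Lemma dotNr x w : dot w (- x) = - dot w x.
Proof. by rewrite dotC dotNl dotC. Qed.

Lemma dotBr x y w : dot w (x - y) = dot w x - dot w y.
Proof. by rewrite dotDr dotNr. Qed.

Definition dotE := (dotDl, dotDr, dotNl, dotNr, dotZl, dotZr).

Lemma dot0l w : dot 0 w = 0.
Proof. by rewrite -(scale0r w) dotZl mul0r. Qed.

Lemma dot_mulmx x y (H : 'M[R]_n) : dot (x *m H) y = dot x (y *m H^T).
Proof. by rewrite !dot_mx trmx_mul trmxK mulmxA. Qed.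

Lemma dot_ge0 x : 0 <= dot x x.
Proof. by apply: sumr_ge0 => i _; rewrite -expr2 sqr_ge0. Qed.

Lemma dot_eq0 x : dot x x <= 0 -> x = 0.
Proof.
move=> x0; have /eqP : dot x x = 0 by apply/le_anti; rewrite x0 dot_ge0.
rewrite psumr_eq0 => [/allP xi|i _]; last by rewrite -expr2 sqr_ge0.
apply/rowP => i; rewrite mxE; apply/eqP.
by have := xi i (mem_index_enum i); rewrite mulf_eq0 orbb.
Qed.

Lemma enorm_ge0 x : 0 <= enorm x.
Proof. exact: sqrtr_ge0. Qed.

Lemma enorm_sqr x : enorm x ^+ 2 = dot x x.
Proof. by rewrite sqr_sqrtr ?dot_ge0. Qed.

Lemma enorm_leP x (c : R) : 0 <= c -> (enorm x <= c) = (dot x x <= c ^+ 2).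
Proof. by move=> c0; rewrite -enorm_sqr ler_sqr ?nnegrE ?enorm_ge0. Qed.

Lemma enorm_le x y : (enorm x <= enorm y) = (dot x x <= dot y y).
Proof. by rewrite enorm_leP ?enorm_ge0// enorm_sqr. Qed.

Lemma cauchy_schwarz x y : dot x y <= enorm x * enorm y.
Proof.
have [x0|x0] := eqVneq (enorm x) 0.
  rewrite x0 mul0r; suff -> : x = 0 by rewrite dot0l.
  by apply: dot_eq0; rewrite -enorm_sqr x0 expr0n.
have [y0|y0] := eqVneq (enorm y) 0.
  rewrite y0 mulr0; suff -> : y = 0 by rewrite dotC dot0l.
  by apply: dot_eq0; rewrite -enorm_sqr y0 expr0n.
have xp : 0 < enorm x by rewrite lt_neqAle eq_sym x0 enorm_ge0.
have yp : 0 < enorm y by rewrite lt_neqAle eq_sym y0 enorm_ge0.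
(* Expanding this square gives [2 * enorm x * enorm y] times the desired inequality; the factor is
   positive since both norms are nonzero here. *)
have := dot_ge0 (enorm y *: x - enorm x *: y).
rewrite !(dotBl, dotBr) !dotZl !dotZr -!enorm_sqr (dotC y x) => H.
by rewrite -(ler_pM2l (mulr_gt0 xp yp)); nra.
Qed.

Lemma enormZ a x : enorm (a *: x) = `|a| * enorm x.
Proof.
by rewrite /enorm dotZl dotZr mulrA -expr2 sqrtrM ?sqr_ge0// sqrtr_sqr.
Qed.

Lemma enormN x : enorm (- x) = enorm x.
Proof. by rewrite /enorm dotNl dotNr opprK. Qed.

Lemma enormB x y : enorm (x - y) = enorm (y - x).
Proof. by rewrite -enormN opprB. Qed.

Lemma enormD x y : enorm (x + y) <= enorm x + enorm y.
Proof.
rewrite enorm_leP ?addr_ge0 ?enorm_ge0//.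
rewrite !(dotDl, dotDr) -!enorm_sqr (dotC y x).
by have := cauchy_schwarz x y; nra.
Qed.

Lemma enorm_sub3 x y w : enorm (x - w) <= enorm (x - y) + enorm (y - w).
Proof.
by rewrite -[x - w](_ : (x - y) + (y - w) = _) ?enormD// addrA subrK.
Qed.

(** Turns estimates obtained by pairing a vector with itself into norm bounds, by dividing by
    [enorm x]; [0 <= c] covers the case where this is zero. *)
Lemma enorm_le_dual x (c : R) : dot x x <= c * enorm x -> 0 <= c -> enorm x <= c.
Proof.
rewrite -enorm_sqr => H c0; have [->//|x0] := eqVneq (enorm x) 0.
have xp : 0 < enorm x by rewrite lt_neqAle eq_sym x0 enorm_ge0.
by rewrite -(ler_pM2r xp) -expr2.
Qed.

(** Links the sup norm, whose balls serve for compactness, to the Euclidean norm of strong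
    convexity. *)
Lemma mx_norm_le_enorm x : `|x| <= enorm x.
Proof.
rewrite /Num.norm/= mx_normrE; apply: bigmax_le; first exact: enorm_ge0.
move=> [i j] _ /=; rewrite (ord1 i).
rewrite -(ger0_norm (enorm_ge0 x)) -ler_sqr ?nnegrE// !real_normK ?num_real//.
rewrite enorm_sqr /dot (bigD1 j)//= -expr2 lerDl.
by apply: sumr_ge0 => k _; rewrite -expr2 sqr_ge0.
Qed.

Lemma cvg_dot (T : Type) (F : set_system T) {FF : Filter F}
    (u : T -> 'rV[R]_n) (l w : 'rV[R]_n) :
  u @ F --> l -> (fun t => dot (u t) w) @ F --> dot l w.
Proof.
move=> ul.
(* The sum is generalized to any list of indices, so that the limit follows by induction. *)
pose S (r : seq 'I_n) (y : 'rV[R]_n) := \sum_(i <- r) y 0 i * w 0 i.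
suff H r : (fun t => S r (u t)) @ F --> S r l by exact: H.
elim: r => [|i r IHr].
  have -> : S [::] = cst 0 by apply/funext => y; rewrite /S big_nil.
  exact: cvg_cst.
have -> : S (i :: r) = (fun y => y 0 i * w 0 i + S r y).
  by apply/funext => y; rewrite /S big_cons.
apply: cvgD IHr.
have ui : (fun t => u t 0 i) @ F --> l 0 i.
  exact: (cvg_comp u (fun y : 'rV[R]_n => y 0 i) ul (@coord_continuous R 1 n 0 i l)).
exact: cvgMr_tmp ui.
Qed.

End InnerProduct.

(** Convexity controls difference quotients only for steps in []0, 1[], so the two-sided limit is
    restricted to the right of 0, where the error [a * e] vanishes. *)
Lemma le_of_right_limit {R : realType} (q : R -> R) (l c e : R) :
  q @ 0^' --> l -> (forall a, 0 < a < 1 -> q a <= c + a * e) -> l <= c.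
Proof.
move=> /cvg_dnbhs_at_right ql H.
have rl : (fun a : R => c + a * e) @ 0^'+ --> c.
  rewrite -[X in _ --> X]addr0 -[X in _ + X](mul0r e).
  apply: cvgD; first exact: cvg_cst.
  by apply: cvgMr_tmp; apply: cvg_at_right_filter; exact: cvg_id.
apply: (ler_cvg_to ql rl).
by near=> a; apply: H; apply/andP; split; near: a;
  [exact: nbhs_right_gt | exact: nbhs_right_lt].
Unshelve. all: by end_near. Qed.

Lemma ge_of_right_limit {R : realType} (q : R -> R) (l c : R) :
  q @ 0^' --> l -> (forall a, 0 < a < 1 -> c <= q a) -> c <= l.
Proof.
move=> /cvg_dnbhs_at_right ql H; apply: (cvgr_to_ge ql).
by near=> a; apply: H; apply/andP; split; near: a;
  [exact: nbhs_right_gt | exact: nbhs_right_lt].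
Unshelve. all: by end_near. Qed.

(** * First-order inequalities for smooth strongly convex functions *)

Section Calculus.
Context {R : realType} {n : nat}.
Implicit Types (x y v w : 'rV[R]_n) (phi : 'rV[R]_n -> R) (m L : R).

(** The gradient is made of partial derivatives; linearity of the differential, applied to the
    decomposition of [v] in the canonical basis, recovers every directional derivative. *)
Lemma diff_quotient_cvg phi x v : differentiable (phi : 'rV[R]_n -> R^o) x ->
  (fun h => h^-1 * (phi (x + h *: v) - phi x)) @ 0^' --> dot (gradient phi x) v.
Proof.
move=> dphi; have dv : derivable (phi : 'rV[R]_n -> R^o) x v.
  exact: diff_derivable.
have -> : dot (gradient phi x) v = 'D_v (phi : 'rV[R]_n -> R^o) x.
  rewrite deriveE// {2}(row_sum_delta v) linear_sum/=; apply: eq_bigr => i _.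
  by rewrite linearZ/= mxE deriveE// mulrC.
move: dv => /cvg_ex[l dv]; rewrite /derive (cvg_lim _ dv)//.
by under eq_fun => h do rewrite (addrC x).
Qed.

Lemma is_derive_line phi x v (s : R) :
  differentiable (phi : 'rV[R]_n -> R^o) (x + s *: v) ->
  is_derive s 1 (fun r => phi (x + r *: v)) (dot (gradient phi (x + s *: v)) v).
Proof.
move=> /diff_quotient_cvg - /(_ v) H.
have e : (fun h => h^-1 *: (phi (x + (h *: (1 : R) + s) *: v) - phi (x + s *: v)))
    = (fun h => h^-1 * (phi (x + s *: v + h *: v) - phi (x + s *: v))) :> (R -> R).
  by apply/funext => h; rewrite -addrA -scalerDl (addrC s) [h *: 1]mulr1.
rewrite -e in H.
by split; [apply/cvg_ex; eexists; exact: H | exact: cvg_lim H].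
Qed.

Lemma strongly_convexE m phi x y (a : R) : 0 <= a <= 1 -> strongly_convex m phi ->
  phi (a *: x + (1 - a) *: y) - m / 2 * enorm (a *: x + (1 - a) *: y) ^+ 2 <=
  a * (phi x - m / 2 * enorm x ^+ 2) + (1 - a) * (phi y - m / 2 * enorm y ^+ 2).
Proof.
move=> /andP[a0 a1] sc.
exact: (sc (Itv01 a0 a1) x y (mem_set I) (mem_set I)).
Qed.

Lemma strongly_convexP m phi :
  (forall x y (a : R), 0 <= a <= 1 ->
    phi (a *: x + (1 - a) *: y) - m / 2 * enorm (a *: x + (1 - a) *: y) ^+ 2 <=
    a * (phi x - m / 2 * enorm x ^+ 2) + (1 - a) * (phi y - m / 2 * enorm y ^+ 2)) ->
  strongly_convex m phi.
Proof. by move=> H t x y _ _; apply: H; rewrite ge0 le1. Qed.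

(** Divide the strong convexity inequality at [x + a *: (y - x)] by [a] and let [a] tend to 0; the
    leftover is [a * (m / 2 * dot (y - x) (y - x))]. *)
Lemma strongly_convex_lower_bound m phi x y :
  strongly_convex m phi -> differentiable (phi : 'rV[R]_n -> R^o) x ->
  phi x + dot (gradient phi x) (y - x) + m / 2 * dot (y - x) (y - x) <= phi y.
Proof.
move=> sc /diff_quotient_cvg - /(_ (y - x)) dphi.
suff : dot (gradient phi x) (y - x) <=
    phi y - phi x - m / 2 * dot (y - x) (y - x) by lra.
apply: (le_of_right_limit dphi (e := m / 2 * dot (y - x) (y - x))) => a /andP[a0 a1].
rewrite ler_pdivrMl//.
have a01 : 0 <= a <= 1 by rewrite !ltW.
have := strongly_convexE y x a01 sc.
have -> : a *: y + (1 - a) *: x = x + a *: (y - x).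
  by rewrite scalerBl scale1r scalerBr addrCA.
rewrite !enorm_sqr.
rewrite !dotE (dotC y x).
by move: (phi _) (phi _) (phi _) => *; nra.
Qed.

Lemma descent L phi x y : L_smooth L phi ->
  phi y <= phi x + dot (gradient phi x) (y - x) + L / 2 * dot (y - x) (y - x).
Proof.
move=> [dphi lip]; set d := y - x.
set c := dot (gradient phi x) d; set k := dot d d.
(* [G] is [phi] along the segment minus its quadratic upper model. Its derivative is nonpositive on
   [[0, 1]] because the gradient is Lipschitz, so the mean value theorem replaces an integration. *)
pose G r : R := phi (x + r *: d) - (r * c + r ^+ 2 * (L / 2 * k)).
have dG (r : R) : is_derive r 1 G
    (dot (gradient phi (x + r *: d)) d - (c + 2 * r * (L / 2 * k))).
  apply: is_deriveB.
    by apply: is_derive_line; exact: dphi.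
  apply: is_derive_eq.
  by rewrite /GRing.scale/=; ring.
have cG : {within `[0, 1], continuous G}.
  by apply: derivable_within_continuous => r _; apply: ex_derive.
have [r] := MVT_segment ler01 (fun r _ => dG r) cG.
rewrite in_itv/= => /andP[r0 r1].
rewrite /G subr0 mulr1 scale1r scale0r addr0 /d addrCA subrr addr0 -/d.
have : dot (gradient phi (x + r *: d)) d - c <= L * r * k.
  rewrite /c -dotBl (le_trans (cauchy_schwarz _ _))//.
  have := lip (x + r *: d) x; rewrite addrAC subrr add0r enormZ ger0_norm// => H.
  rewrite /k -enorm_sqr expr2 mulrA ler_wpM2r ?enorm_ge0//.
  by rewrite -mulrA.
by nra.
Qed.

Lemma strongly_monotone m phi x y :
  strongly_convex m phi -> (forall z, differentiable (phi : 'rV[R]_n -> R^o) z) ->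
  m * dot (x - y) (x - y) <= dot (gradient phi x - gradient phi y) (x - y).
Proof.
move=> sc dphi.
have := strongly_convex_lower_bound y sc (dphi x).
have := strongly_convex_lower_bound x sc (dphi y).
rewrite -(opprB x y) !dotE; lra.
Qed.

Definition sector m L phi := forall x y,
  let u := gradient phi x - gradient phi y in
  0 <= dot (u - m *: (x - y)) (L *: (x - y) - u).

(* Baillon-Haddad for [phi - m / 2 * |.| ^+ 2], with the gradient step [t]
   optimized at the end so that the case [m = L] is included. *)
Lemma smooth_strongly_convex_sector m L phi : m <= L ->
  strongly_convex m phi -> L_smooth L phi -> sector m L phi.
Proof.
move=> mL sc sm x y; have [dphi _] := sm; cbv zeta.
set u := _ - gradient phi y; set d := x - y; set w := u - m *: d.
(* At the point [z = b - t *: v], the lower bound of [phi] from [a] is compared with its upper bound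
   from [b]. *)
have bregman a b (t : R) : let v := gradient phi b - gradient phi a - m *: (b - a) in
    phi a + dot (gradient phi a) (b - a) + m / 2 * dot (b - a) (b - a)
      + t * dot v v - (L - m) / 2 * t ^+ 2 * dot v v <= phi b.
  move=> v; set z := b - t *: v.
  have H1 := strongly_convex_lower_bound z sc (dphi a).
  have H2 := descent b z sm.
  have vE : dot v v = dot (gradient phi b) v - dot (gradient phi a) v - m * dot (b - a) v.
    by rewrite {1}/v !dotBl dotZl dotBl.
  have e1 : z - a = (b - a) - t *: v by rewrite /z addrAC.
  have e2 : z - b = - (t *: v) by rewrite /z addrAC subrr add0r.
  have tvE := congr1 ( *%R t) vE.
  clearbody z; clearbody v; move: H1 H2 tvE; rewrite e1 e2 !dotE (dotC v b) (dotC v a); lra.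
(* Sum of [bregman] for [(x, y)] and [(y, x)]: the values of [phi] cancel. *)
have key t : 2 * t * dot w w - (L - m) * t ^+ 2 * dot w w <= dot w d.
  have H1 := bregman x y t; have H2 := bregman y x t; cbv zeta in H1, H2.
  have wN : gradient phi y - gradient phi x - m *: (y - x) = - w.
    rewrite -(opprB x y) -(opprB (gradient phi x)) scalerN opprK.
    by rewrite [RHS]opprB [RHS]addrC.
  have wd : dot w d = dot (gradient phi x) d - dot (gradient phi y) d - m * dot d d.
    by rewrite /w dotBl dotBl dotZl.
  rewrite wN -(opprB x y) -/d !(dotNl, dotNr) !opprK in H1.
  rewrite -/u -/d -/w in H2.
  by lra.
have -> : L *: d - u = (L - m) *: d - w.
  by rewrite /w scalerBl [in RHS]opprB [RHS]addrA subrK.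
rewrite dotBr dotZr; have w0 := dot_ge0 w.
have [LE|Lm] := eqVneq L m.
  rewrite LE subrr mul0r sub0r oppr_ge0.
  (* For [L = m] the left side of [key] is linear in [t], hence unbounded unless [w = 0]; this [t]
     makes it equal to [dot w d + 1]. *)
  rewrite leNgt; apply/negP => wp; have := key ((dot w d + 1) / (2 * dot w w)).
  rewrite LE subrr !mul0r subr0 mulrAC mulrCA mulfV ?gt_eqF ?mulr_gt0//; lra.
have Lmp : 0 < L - m by rewrite subr_gt0 lt_neqAle eq_sym Lm.
have := key (L - m)^-1; rewrite -(ler_pM2l Lmp) => /(le_trans _) H.
rewrite subr_ge0 H// le_eqVlt; apply/orP; left; apply/eqP; field.
by rewrite gt_eqF.
Qed.

End Calculus.

(** * Contraction factors from the sector inequality *)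

Section Sector.
Context {R : realType} {n : nat}.
Implicit Types (x y d u : 'rV[R]_n) (phi : 'rV[R]_n -> R) (m L rho : R).

(** For [m < L], pair [(L - m) *: d = (L *: d - u) + (u - m *: d)] with [u - m *: d] for the lower
    bound and with [L *: d - u] for the upper one. For [m = L] the hypothesis forces
    [u = m *: d]. *)
Lemma sector_bounds m L d u : m <= L -> 0 <= dot (u - m *: d) (L *: d - u) ->
  m * dot d d <= dot u d <= L * dot d d.
Proof.
rewrite le_eqVlt => /orP[/eqP<-|mL] H.
  have /eqP : u - m *: d = 0.
    by apply: dot_eq0; rewrite -oppr_ge0 -dotNr opprB.
  by rewrite subr_eq0 => /eqP ->; rewrite dotZl lexx.
have Lm : 0 < L - m by rewrite subr_gt0.
have u0 := dot_ge0 (u - m *: d).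
have u1 := dot_ge0 (L *: d - u).
by apply/andP; split; rewrite -subr_ge0 -(pmulr_rge0 _ Lm);
  move: H u0 u1; rewrite !dotE (dotC d u); lra.
Qed.

(* A quadratic form in [(d, u)] bounded below through the sector inequality is
   affine in [dot u d], hence is checked at [u = m *: d] and [u = L *: d]. *)
Lemma affine_ge0 (m L A D c0 c1 : R) : 0 <= A -> m * A <= D <= L * A ->
  0 <= c0 + c1 * m -> 0 <= c0 + c1 * L -> 0 <= c0 * A + c1 * D.
Proof.
move=> A0 /andP[mD DL] h1 h2; case: (leP 0 c1) => c1s.
  by have := mulr_ge0 c1s (_ : 0 <= D - m * A); have := mulr_ge0 h1 A0; lra.
have c1n : 0 <= - c1 by rewrite oppr_ge0 ltW.
by have := mulr_ge0 c1n (_ : 0 <= L * A - D); have := mulr_ge0 h2 A0; lra.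
Qed.

(** Subtracting [rho ^+ 2] times the sector inequality from the squared bound cancels [dot u u]. The
    remainder, affine in [dot u d], has endpoint coefficients [zeta^2 - (1 - rho m)^2] and
    [zeta^2 - (1 - rho L)^2]. *)
Lemma sector_forward m L rho d u : m <= L -> 0 <= dot (u - m *: d) (L *: d - u) ->
  enorm (d - rho *: u) <= zetaFB m L rho * enorm d.
Proof.
move=> mL H; have z0 : 0 <= zetaFB m L rho by rewrite le_max normr_ge0.
rewrite enorm_leP ?mulr_ge0 ?enorm_ge0// exprMn enorm_sqr.
have h1 : (1 - rho * m) ^+ 2 <= zetaFB m L rho ^+ 2.
  rewrite -[leLHS]real_normK ?num_real// ler_sqr ?nnegrE//.
  by rewrite le_max lexx.
have h2 : (1 - rho * L) ^+ 2 <= zetaFB m L rho ^+ 2.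
  rewrite -[leLHS]real_normK ?num_real// ler_sqr ?nnegrE//.
  by rewrite le_max lexx orbT.
move: (zetaFB _ _ _ ^+ 2) h1 h2 => z h1 h2.
have := @affine_ge0 m L _ _ (z - 1 + rho ^+ 2 * m * L)
  (2 * rho - rho ^+ 2 * (m + L)) (dot_ge0 d) (sector_bounds mL H).
have := mulr_ge0 (sqr_ge0 rho) H; rewrite !dotE (dotC d u).
move: (dot d d) (dot u d) (dot u u) => A B D H1 H2.
have : 0 <= (z - 1 + rho ^+ 2 * m * L) * A + (2 * rho - rho ^+ 2 * (m + L)) * B.
  by apply: H2; lra.
by lra.
Qed.

(* With [a = zeta^-1 - 1], so that [a <= rho m] and [rho L <= a^-1], the vector
   [rho u] satisfies the sector inequality with bounds [a, a^-1], whose Cayley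
   transform is the ball of radius [(1 - a) / (1 + a) = 2 zeta - 1]. *)
Lemma sector_reflected m L rho d u : 0 < m -> m <= L -> 0 < rho ->
  0 <= dot (u - m *: d) (L *: d - u) ->
  enorm (d - rho *: u) <= (2 * zetaDR m L rho - 1) * enorm (d + rho *: u).
Proof.
move=> m0 mL rho0 H; have L0 := lt_le_trans m0 mL.
have p := mulr_gt0 rho0 m0; have q := mulr_gt0 rho0 L0.
have pq : rho * m <= rho * L by rewrite ler_pM2l.
have h1 : 1 <= (1 + rho * m) * zetaDR m L rho.
  by rewrite -ler_pdivrMl ?addr_gt0// mulrC le_max lexx.
have h2 : rho * L <= (1 + rho * L) * zetaDR m L rho.
  by rewrite -ler_pdivrMl ?addr_gt0// mulrC le_max lexx orbT.
have z1 : zetaDR m L rho <= 1.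
  by rewrite ge_max !ler_pdivrMr ?addr_gt0// !mul1r; apply/andP; split; lra.
move: (zetaDR _ _ _) h1 h2 z1 => z h1 h2 z1.
have z2 : 0 <= 2 * z - 1 by nra.
rewrite enorm_leP ?mulr_ge0 ?enorm_ge0// exprMn enorm_sqr.
(* A quarter of the goal, minus [(1 - z) * z * rho ^+ 2] times the sector inequality: this
   multiplier cancels [dot u u]. *)
have := @affine_ge0 m L _ _ ((1 - z) * z * (rho ^+ 2 * m * L - 1))
  (rho * (z ^+ 2 + (1 - z) ^+ 2) - (1 - z) * z * rho ^+ 2 * (m + L))
  (dot_ge0 d) (sector_bounds mL H).
have zz : 0 <= (1 - z) * z by nra.
have := mulr_ge0 (mulr_ge0 zz (sqr_ge0 rho)) H; rewrite !dotE (dotC d u).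
move: (dot d d) (dot u d) (dot u u) => A B D H1 H2.
suff : 0 <= ((1 - z) * z * (rho ^+ 2 * m * L - 1)) * A +
  (rho * (z ^+ 2 + (1 - z) ^+ 2) - (1 - z) * z * rho ^+ 2 * (m + L)) * B by lra.
apply: H2.
(* The value at each endpoint factors; the signs of the factors come from [h1] and [h2], carried to
   the other endpoint by [pq]. *)
- have : 0 <= (rho * m * z - (1 - z)) * (z - (1 - z) * (rho * m)) by apply: mulr_ge0; nra.
  by lra.
- have : 0 <= (rho * L * z - (1 - z)) * (z - (1 - z) * (rho * L)) by apply: mulr_ge0; nra.
  by lra.
Qed.

End Sector.

(** * Quadratic functions *)

Section Quadratic.
Context {R : realType} {n : nat}.
Implicit Types (x y v w b : 'rV[R]_n) (H : 'M[R]_n) (m L : R).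

Lemma differentiable_quadratic b H x0 x :
  differentiable (quadratic b H x0 : 'rV[R]_n -> R^o) x.
Proof.
have dcoord (c : 'rV[R]_n) i :
    differentiable ((fun y : 'rV[R]_n => (y - c) 0 i) : 'rV[R]_n -> R^o) x.
  have -> : (fun y : 'rV[R]_n => (y - c) 0 i) = (fun y => y 0 i) - cst (c 0 i).
    by apply/funext => y; rewrite !mxE.
  by apply: differentiableB; [exact: differentiable_coord | exact: differentiable_cst].
have dsum (F : 'I_n -> 'rV[R]_n -> R) :
    (forall i, differentiable (F i : 'rV[R]_n -> R^o) x) ->
    differentiable ((fun y => \sum_(i < n) F i y) : 'rV[R]_n -> R^o) x.
  move=> dF; rewrite (_ : (fun y => _) = \sum_(i < n) (F i : 'rV[R]_n -> R^o)).
    exact: differentiable_sum.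
  by apply/funext => y; rewrite fct_sumE.
apply: differentiableD.
  by apply: dsum => i; apply: differentiableM; [exact: differentiable_cst|exact: dcoord].
apply: differentiableM; first exact: differentiable_cst.
apply: (dsum) => i; apply: differentiableM; last exact: dcoord.
have -> : (fun y => ((y - x0) *m H) 0 i) = (fun y => \sum_(j < n) (y - x0) 0 j * H j i).
  by apply/funext => y; rewrite mxE.
by apply: dsum => j; apply: differentiableM; [exact: dcoord|exact: differentiable_cst].
Qed.

Lemma quadratic_strongly_convex b H x0 m : H^T = H ->
  (forall v, m * dot v v <= dot (v *m H) v) -> strongly_convex m (quadratic b H x0).
Proof.
move=> Hs Hm; apply: strongly_convexP => x y a /andP[a0 a1].
rewrite -(subrK x0 x) -(subrK x0 y).
move: (x - x0) (y - x0) => X Y; rewrite /quadratic.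
have -> : a *: (X + x0) + (1 - a) *: (Y + x0) = a *: X + (1 - a) *: Y + x0.
  by rewrite !scalerDr addrACA -scalerDl addrC [a + _]addrC subrK scale1r addrC.
rewrite !addrK !enorm_sqr mulmxDl -!scalemxAl !dotE.
have -> : dot (Y *m H) X = dot (X *m H) Y by rewrite dot_mulmx Hs dotC.
rewrite (dotC Y X) (dotC x0 X) (dotC x0 Y).
(* The convexity gap is [a * (1 - a) / 2] times the value at [X - Y] of the form of [H] minus [m]
   times the squared norm. *)
have aa : 0 <= a * (1 - a) by rewrite mulr_ge0// subr_ge0.
have := Hm (X - Y); rewrite mulmxBl !dotE (dotC Y X).
have -> : dot (Y *m H) X = dot (X *m H) Y by rewrite dot_mulmx Hs dotC.
by rewrite -subr_ge0 => /(mulr_ge0 aa); lra.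
Qed.

Lemma quadratic_L_smooth b H x0 L : H^T = H -> 0 <= L ->
  (forall v w, dot (v *m H) w <= L * enorm v * enorm w) ->
  L_smooth L (quadratic b H x0).
Proof.
move=> Hs L0 HL; split=> [x|x y]; first exact: differentiable_quadratic.
rewrite !gradient_quadratic// opprD addrACA subrr add0r -mulmxBl opprB addrA subrK.
by apply: enorm_le_dual; [exact: HL | rewrite mulr_ge0 ?enorm_ge0].
Qed.

(* Passing to the symmetric part of the Hessian of [f] makes it unnecessary to
   prove that this Hessian is symmetric. *)
Lemma quadratic_sym b H x0 : quadratic b H x0 = quadratic b (2^-1 *: (H + H^T)) x0.
Proof.
apply/funext => x; rewrite /quadratic -scalemxAr mulmxDr dotZl dotDl.
rewrite (dot_mulmx _ _ H^T) trmxK (dotC (x - x0)).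
by congr (_ + _); field.
Qed.

(** Makes [prox] an instance of minimizing a smooth strongly convex function plus [gam]. *)
Lemma prox_term_quadratic (rho : R) x y :
  (2 * rho)^-1 * enorm (y - x) ^+ 2 = quadratic 0 (rho^-1)%:M x y.
Proof.
rewrite /quadratic dot0l add0r enorm_sqr mul_mx_scalar dotZl invfM mulrA.
by [].
Qed.

End Quadratic.

(** * Bounds on the Hessian, as limits of bounds on gradient differences *)

Section Hessian.
Context {R : realType} {n : nat}.
Implicit Types (x y v w : 'rV[R]_n) (phi : 'rV[R]_n -> R) (m L : R).

Lemma hessian_quotient_cvg phi x v w : differentiable (gradient phi) x ->
  (fun h => h^-1 * dot (gradient phi (x + h *: v) - gradient phi x) w) @ 0^' -->
  dot (v *m hessian phi x) w.
Proof.
move=> dg; have dv : derivable (gradient phi) x v by exact: diff_derivable.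
rewrite /hessian -deriveEjacobian//.
move: dv => /cvg_ex[l dv]; rewrite /derive (cvg_lim _ dv)//.
have -> : (fun h => h^-1 * dot (gradient phi (x + h *: v) - gradient phi x) w) =
    (fun h => dot (h^-1 *: ((gradient phi \o shift x) (h *: v) - gradient phi x)) w).
  by apply/funext => h; rewrite dotZl /= (addrC _ x).
exact: cvg_dot dv.
Qed.

Lemma hessian_ge m phi x v : strongly_convex m phi ->
  (forall y, differentiable (phi : 'rV[R]_n -> R^o) y) ->
  differentiable (gradient phi) x -> m * dot v v <= dot (v *m hessian phi x) v.
Proof.
move=> sc dphi /hessian_quotient_cvg - /(_ v v) H.
apply: (cvgr_to_ge H); near=> h.
have h0 : h != 0 by near: h; exact: nbhs_dnbhs_neq.
have := strongly_monotone (x + h *: v) x sc dphi.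
rewrite addrAC subrr add0r !dotZr dotZl => H1.
(* The increment [h] may be negative, so the inequality is multiplied by its square. *)
have h2 : 0 < h ^+ 2 by rewrite exprn_even_gt0.
rewrite -(ler_pM2l h2) [leRHS]mulrA expr2 mulfK//.
by apply: le_trans H1; rewrite !mulrA (mulrC m h) -(mulrA h m) (mulrC m h) !mulrA.
Unshelve. all: by end_near. Qed.

(** The bound is bilinear so that it passes to the symmetric part of the Hessian and gives a
    Lipschitz gradient for the model. *)
Lemma hessian_le L phi x v w : L_smooth L phi ->
  differentiable (gradient phi) x ->
  dot (v *m hessian phi x) w <= L * enorm v * enorm w.
Proof.
move=> [_ lip] /hessian_quotient_cvg - /(_ v w) H.
apply: (cvgr_to_le H); near=> h.
have h0 : h != 0 by near: h; exact: nbhs_dnbhs_neq.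
have := lip (x + h *: v) x; rewrite addrAC subrr add0r enormZ => H1.
apply: (le_trans (ler_norm _)); rewrite normrM normfV.
rewrite ler_pdivrMl ?normr_gt0//.
rewrite [leRHS](_ : _ = L * (`|h| * enorm v) * enorm w); last by ring.
apply: (@le_trans _ _ (enorm (gradient phi (x + h *: v) - gradient phi x) * enorm w)).
  rewrite ler_norml cauchy_schwarz andbT lerNl -dotNl.
  by rewrite (le_trans (cauchy_schwarz _ _))// enormN.
by rewrite ler_wpM2r ?enorm_ge0.
Unshelve. all: by end_near. Qed.

End Hessian.

(** * Lipschitz dependence of the gradient on time *)

Section TimeLipschitz.
Context {R : realType} {n : nat}.
Implicit Types (f : 'rV[R]_n -> R -> R) (x : 'rV[R]_n).

(** Near a positive time the restriction to nonnegative times is void, so there [dt_gradient] is an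
    ordinary two-sided derivative. *)
Lemma shift_cvg_time_nbhs (s : R) : 0 < s -> (fun h => h + s) @ 0^' --> time_nbhs s.
Proof.
move=> s0 A sA.
have cs : (fun h : R => h + s) @ 0 --> s.
  by rewrite -[X in _ --> X]add0r; exact: (cvgD cvg_id (cvg_cst s)).
have h1 : \forall h \near (0 : R)^', 0 <= h + s.
  have ev : \forall r \near s, 0 <= r.
    by near=> r; apply: ltW; near: r; exact: lt_nbhsr.
  exact: nbhs_dnbhs (cs _ ev).
have h2 : \forall h \near (0 : R)^', h + s != s -> 0 <= h + s -> A (h + s).
  exact: nbhs_dnbhs (cs (fun r => r != s -> 0 <= r -> A r) sA).
rewrite /= /nbhs/=; near=> h.
apply: (near h2 h) => //; last by near: h.
by rewrite -subr_eq0 addrK; near: h; exact: nbhs_dnbhs_neq.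
Unshelve. all: by end_near. Qed.

Lemma gradient_time_derivative f x (s : R) w : 0 < s ->
  cvg (grad_quotient f x s @ time_nbhs s) ->
  is_derive s 1 (fun r => dot (gradient (f^~ r) x) w) (dot (dt_gradient f x s) w).
Proof.
move=> s0 cv.
have H := cvg_dot (w := w) (cvg_comp _ _ (shift_cvg_time_nbhs s0) cv).
have e : (fun h => h^-1 *: (dot (gradient (f^~ (h *: (1 : R) + s)) x) w
      - dot (gradient (f^~ s) x) w)) =
    (fun h => dot (grad_quotient f x s (h + s)) w) :> (R -> R).
  by apply/funext => h; rewrite /grad_quotient addrK dotZl dotBl [h *: 1]mulr1.
rewrite -[lim _]/(dt_gradient f x s) -e in H.
by split; [apply/cvg_ex; eexists; exact: H | apply: cvg_lim => //; exact: H].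
Qed.

(** Covers [s = 0], the possible left end of the interval in the mean value theorem: the increment
    is [r - s] times a convergent quotient. *)
Lemma gradient_time_right_continuous f x (s : R) w : 0 <= s ->
  cvg (grad_quotient f x s @ time_nbhs s) ->
  (fun r => dot (gradient (f^~ r) x) w) @ s^'+ --> dot (gradient (f^~ s) x) w.
Proof.
move=> s0 cv.
have rs : s^'+ `=>` time_nbhs s.
  move=> A sA.
  have sA' : \forall r \near s, r != s -> 0 <= r -> A r := sA.
  change (\forall r \near s, s < r -> A r); near=> r => sr.
  by apply: (near sA' r); rewrite ?gt_eqF ?(le_trans s0 (ltW sr))//; near: r.
have H := cvg_dot (w := w) (cvg_trans (cvg_app _ rs) cv).
have H2 : (fun r => (r - s) * dot (grad_quotient f x s r) w +
    dot (gradient (f^~ s) x) w) @ s^'+ --> dot (gradient (f^~ s) x) w.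
  have c1 : (fun r => r - s) @ s^'+ --> 0.
    rewrite -(subrr s); apply: cvgB; last exact: cvg_cst.
    by apply: cvg_at_right_filter; exact: cvg_id.
  have := cvgD (cvgM c1 (H _)) (cvg_cst (dot (gradient (f^~ s) x) w)).
  by rewrite mul0r add0r; apply.
apply: cvg_trans H2; apply: near_eq_cvg; near=> r.
have rs0 : r - s != 0 by rewrite subr_eq0 gt_eqF//; near: r; exact: nbhs_right_gt.
by rewrite /grad_quotient dotZl dotBl mulVKf// subrK.
Unshelve. all: by end_near. Qed.

(** The mean value theorem is scalar, so it is applied to the gradient paired with its total
    increment [w]; [enorm_le_dual] then removes the pairing. *)
Lemma gradient_time_lipschitz f x (C0 a b : R) : regular_cost f ->
  (forall tau, 0 <= tau -> enorm (dt_gradient f x tau) <= C0) ->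
  0 <= a -> a <= b ->
  enorm (gradient (f^~ b) x - gradient (f^~ a) x) <= C0 * (b - a).
Proof.
move=> [[_ _ cv] _] bnd a0; rewrite le_eqVlt => /orP[/eqP->|ab].
  by rewrite !subrr mulr0 /enorm dot0l sqrtr0.
have C00 : 0 <= C0 by rewrite (le_trans _ (bnd _ a0))// enorm_ge0.
apply: enorm_le_dual; last by rewrite mulr_ge0// subr_ge0 ltW.
set w := _ - _; rewrite {1}/w dotBl.
pose F s := dot (gradient (f^~ s) x) w.
have dF (s : R) : 0 < s -> is_derive s 1 F (dot (dt_gradient f x s) w).
  by move=> s0; apply: gradient_time_derivative => //; apply: cv; exact: ltW.
have cF (s : R) : 0 < s -> {for s, continuous F}.
  move=> s0; apply: differentiable_continuous; apply/derivable1_diffP.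
  by have [] := dF _ s0.
have gt0 s : s \in `]a, b[ -> 0 < s.
  by rewrite in_itv/= => /andP[/(le_lt_trans a0)].
have cFw : {within `[a, b], continuous F}.
  apply/(continuous_within_itvP _ ab); split.
  - by move=> s /gt0 /cF.
  - by apply: gradient_time_right_continuous => //; exact: cv.
  - by apply: cvg_at_left_filter; exact: (cF b (le_lt_trans a0 ab)).
have [s] := MVT ab (fun s sab => dF s (gt0 s sab)) cFw.
rewrite in_itv/= => /andP[as_ sb] ->.
rewrite mulrAC ler_wpM2r//; first by rewrite subr_ge0 ltW.
rewrite (le_trans (cauchy_schwarz _ _))// ler_wpM2r ?enorm_ge0//.
by rewrite bnd// (le_trans a0)// ltW.
Qed.

End TimeLipschitz.

(** * Existence, optimality conditions and uniqueness of minimizers; proximal operators *)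

Section Minimizers.
Context {R : realType} {n : nat}.
Implicit Types (x y z p q v w : 'rV[R]_n) (phi : 'rV[R]_n -> R).
Implicit Types (gam F : 'rV[R]_n -> \bar R) (m rho a : R).

(** The sublevel sets of [F] that meet [K] generate a proper filter on [K]; a cluster point lies in
    all of them, as they are closed, and so is a minimizer. *)
Lemma compact_sublevel_min (K : set 'rV[R]_n) F x0 (c0 : R) :
  compact K -> K x0 -> (F x0 <= c0%:E)%E -> (forall x, F x != -oo%E) ->
  (forall a, closed [set x | (F x <= a%:E)%E]) ->
  exists2 p, K p & forall y, K y -> (F p <= F y)%E.
Proof.
move=> cK Kx0 Fx0 FNy cF.
pose D := [set a : R | exists2 y, K y & (F y <= a%:E)%E].
pose B a := K `&` [set x | (F x <= a%:E)%E].
have PF : ProperFilter (filter_from D B).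
  apply: filter_from_proper.
    apply: filter_from_filter; first by exists c0, x0.
    move=> a b Da Db; exists (Num.min a b).
      by rewrite /Num.min; case: ifP.
    by move=> x [Kx]; rewrite /= EFin_min le_min => /andP[].
  by move=> a [y Ky Fy]; exists y.
have [p [Kp clp]] : K `&` cluster (filter_from D B) !=set0.
  by apply: cK; exists c0; [exists x0 | move=> x []].
exists p => // y Ky.
have Fp a : D a -> (F p <= a%:E)%E.
  move=> Da; apply: (cF a) => U Up.
  by have [z [[_ Fz] Uz]] := clp (B a) U (ex_intro2 _ _ a Da (fun z Bz => Bz)) Up; exists z.
case Fy : (F y) => [r||]; [|by rewrite leey|by have := FNy y; rewrite Fy].
by apply: Fp; exists y; rewrite // Fy.
Qed.

Lemma compact_normB_le x0 (r : R) : compact [set x : 'rV[R]_n | `|x - x0| <= r].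
Proof.
apply: bounded_closed_compact.
  exists (r + `|x0|); split; first exact: num_real.
  move=> M rM x /= xr; apply: le_trans (ltW rM).
  by rewrite -[x in `|x|](subrK x0) (le_trans (ler_normD _ _))// lerD2r.
have cn : continuous (fun x : 'rV[R]_n => `|x - x0|).
  by move=> x; exact: (cvg_norm (cvgB cvg_id (cvg_cst x0))).
apply: (@preimage_closed _ _ (fun x : 'rV[R]_n => `|x - x0|) [set s : R | s <= r]).
  by move=> x _; exact: cn.
exact: closed_le.
Qed.

Lemma strongly_convex_combination m phi x y a :
  strongly_convex m phi -> 0 <= a <= 1 ->
  phi (a *: x + (1 - a) *: y) <= a * phi x + (1 - a) * phi y
    - m / 2 * (a * (1 - a)) * dot (x - y) (x - y).
Proof.
move=> sc a01; have := strongly_convexE x y a01 sc.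
by rewrite !enorm_sqr !dotE (dotC y x); lra.
Qed.

Section Sum.
Variables (m : R) (phi : 'rV[R]_n -> R) (gam : 'rV[R]_n -> \bar R).
Hypotheses (m_gt0 : 0 < m) (sc : strongly_convex m phi).
Hypothesis dphi : forall x, differentiable (phi : 'rV[R]_n -> R^o) x.
Hypotheses (cl_gam : eclosed gam) (cvx_gam : econvex gam) (pr_gam : eproper gam).

Let F x := ((phi x)%:E + gam x)%E.

Lemma econvex_fin x y a (r s : R) : 0 <= a <= 1 -> gam x = r%:E -> gam y = s%:E ->
  (gam (a *: x + (1 - a) *: y)%R <= (a * r + (1 - a) * s)%:E)%E.
Proof. by move=> /(cvx_gam x y) + gx gy; rewrite gx gy -!EFinM -EFinD. Qed.

Lemma eproper_fin : exists x r, gam x = r%:E.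
Proof.
have [gNy [x gx]] := pr_gam; exists x; move: gx (gNy x).
by case: (gam x) => // r _ _; exists r.
Qed.

Lemma closed_sublevel_sum a : closed [set x | (F x <= a%:E)%E].
Proof.
(* The sublevel set is the preimage of the closed epigraph of [gam] under a continuous map. *)
have -> : [set x | (F x <= a%:E)%E] = (fun x => (x, a - phi x)) @^-1`
    [set p : 'rV[R]_n * R | (gam p.1 <= p.2%:E)%E].
  by apply/seteqP; split => x /=; rewrite /F EFinB leeBrDl// ?addeC.
apply: preimage_closed cl_gam => x _.
exact: (cvg_pair cvg_id (cvgB (cvg_cst a) (differentiable_continuous (dphi x)))).
Qed.

(* Strong convexity turns the minimum over the unit ball around a point of the
   domain of [gam] into a quadratic lower bound outside of it; no affine minorant
   of [gam] is needed. *)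
Lemma exists_argmin_sum : exists p, forall y, (F p <= F y)%E.
Proof.
have [gNy _] := pr_gam.
have FNy x : F x != -oo%E by have := gNy x; rewrite /F; case: (gam x).
have [x0 [r0 g0]] := eproper_fin.
have Fx0 : F x0 = (phi x0 + r0)%:E by rewrite /F g0.
set F0 := phi x0 + r0 in Fx0.
have ball_min (r : R) : 0 <= r -> exists2 p, `|p - x0| <= r &
    forall y, `|y - x0| <= r -> (F p <= F y)%E.
  move=> r0'; apply: (@compact_sublevel_min [set x | `|x - x0| <= r] F x0 F0) => //=.
  - exact: compact_normB_le.
  - by rewrite subrr normr0.
  - by rewrite Fx0.
  - exact: closed_sublevel_sum.
have [p1 _ p1min] := ball_min _ ler01.
have p1F0 : (F p1 <= F0%:E)%E by rewrite -Fx0 p1min// subrr normr0.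
have [mu Fp1] : exists mu, F p1 = mu%:E.
  by move: p1F0 (FNy p1); case: (F p1) => // mu _ _; exists mu.
move: p1F0; rewrite Fp1 lee_fin => muF.
(* Chosen so that [r > rad] means [m / 2 * (r - 1) > F0 - mu], the growth that forces [F y] above
   [F0]. *)
pose rad := 1 + 2 * (F0 - mu) / m.
have rad1 : 1 <= rad.
  by rewrite lerDl divr_ge0 ?(ltW m_gt0)// mulr_ge0// subr_ge0.
have [p2 _ p2min] := ball_min rad (le_trans ler01 rad1).
exists p2 => y; case: (leP `|y - x0| rad) => [|yr]; first exact: p2min.
have Fp2 : (F p2 <= F0%:E)%E.
  by rewrite -Fx0 p2min// subrr normr0 (le_trans ler01).
apply: (le_trans Fp2).
case gy : (gam y) => [s||]; last by have := gNy y; rewrite gy.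
- rewrite /F gy -EFinD lee_fin.
  set r := `|y - x0| in yr.
  have r1 : 1 < r by exact: le_lt_trans yr.
  have rp : 0 < r by exact: lt_trans r1.
  have a01 : 0 <= r^-1 <= 1 by rewrite invr_ge0 (ltW rp) invf_le1// ltW.
  (* The segment from [x0] to [y] leaves the unit ball at this point, where [F] is at least [mu];
     strong convexity along the segment then bounds [F y] from below. *)
  have /p1min : `|r^-1 *: y + (1 - r^-1) *: x0 - x0| <= 1.
    rewrite scalerBl scale1r addrA addrAC addrK -scalerBr normrZ.
    by rewrite ger0_norm ?invr_ge0 ?(ltW rp)// -/r mulVf ?gt_eqF.
  rewrite Fp1 => /le_trans H.
  have := H _ (leeD (lexx _) (econvex_fin a01 gy g0)).
  rewrite -EFinD lee_fin => {}H.
  have := strongly_convex_combination y x0 sc a01.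
  have : r ^+ 2 <= dot (y - x0) (y - x0).
    by rewrite -enorm_sqr ler_sqr ?nnegrE ?enorm_ge0 ?(ltW rp)// mx_norm_le_enorm.
  move: (dot _ _) => d rd H2.
  have e : r^-1 * r = 1 by rewrite mulVf// gt_eqF.
  have yr' : F0 - mu < m / 2 * (r - 1).
    by move: yr; rewrite /rad -ltrBrDl ltr_pdivrMr//; lra.
  have H3 : mu <= r^-1 * (phi y + s) + (1 - r^-1) * F0
      - m / 2 * (r^-1 * (1 - r^-1)) * r ^+ 2.
    have : m / 2 * (r^-1 * (1 - r^-1)) * r ^+ 2 <= m / 2 * (r^-1 * (1 - r^-1)) * d.
      by rewrite ler_wpM2l// !mulr_ge0 ?invr_ge0 ?(ltW rp) ?(ltW m_gt0)// subr_ge0 invf_le1// ltW.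
    by rewrite /F0; lra.
  have := ler_wpM2l (ltW rp) H3.
  have -> : r * (r^-1 * (phi y + s) + (1 - r^-1) * F0
      - m / 2 * (r^-1 * (1 - r^-1)) * r ^+ 2) =
      phi y + s + (r - 1) * F0 - m / 2 * (r - 1) * r by field; rewrite gt_eqF.
  by have := ler_wpM2l (ltW rp) (ltW yr'); lra.
- by rewrite /F gy addey ?leey.
Qed.

End Sum.

(** Finiteness is required because at [gam p = -oo] the inequality would hold for every [v]. *)
Definition subgradient gam p v :=
  gam p \is a fin_num /\ forall y, (gam p + (dot v (y - p))%:E <= gam y)%E.

Lemma subgradient_monotone gam p q v w :
  subgradient gam p v -> subgradient gam q w -> 0 <= dot (v - w) (p - q).
Proof.
move=> [/fineK gp Hp] [/fineK gq Hq].
have := Hp q; have := Hq p; rewrite -gp -gq -!EFinD !lee_fin -(opprB p q) !dotE.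
by lra.
Qed.

(** Fermat's rule: compare [p] with [p + a *: (y - p)], bound [gam] there by convexity, divide by
    [a] and let [a] tend to 0. Comparison with a point of the domain makes [gam p] finite. *)
Lemma minimizer_subgradient phi gam p :
  differentiable (phi : 'rV[R]_n -> R^o) p -> econvex gam -> eproper gam ->
  (forall y, ((phi p)%:E + gam p <= (phi y)%:E + gam y)%E) ->
  subgradient gam p (- gradient phi p).
Proof.
move=> dp cg pg pmin.
have [gNy _] := pg; have [x0 [r0 g0]] := eproper_fin pg.
have [r gp] : exists r, gam p = r%:E.
  have := pmin x0; have := gNy p; rewrite g0.
  by case: (gam p) => [r|//|//] _ _; exists r.
split=> [|y]; first by rewrite gp.
case gy : (gam y) => [s||]; [|by rewrite leey|by have := gNy y; rewrite gy].
rewrite gp -EFinD lee_fin dotNl -lerBrDl lerNl.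
apply: (ge_of_right_limit (diff_quotient_cvg (v := y - p) dp)) => a /andP[a0 a1].
rewrite ler_pdivlMl//.
have a01 : 0 <= a <= 1 by rewrite !ltW.
have := le_trans (pmin _) (leeD (lexx _) (econvex_fin cg a01 gy gp)).
rewrite gp -!EFinD lee_fin.
have -> : a *: y + (1 - a) *: p = p + a *: (y - p).
  by rewrite scalerBl scale1r scalerBr addrCA.
by lra.
Qed.

(** Testing the subgradient inequality in the direction [d = v - gradient phi p] gives
    [dot d d <= 0] in the limit. *)
Lemma subgradient_smooth phi p v : differentiable (phi : 'rV[R]_n -> R^o) p ->
  subgradient (EFin \o phi) p v -> v = gradient phi p.
Proof.
move=> dp [_ H]; apply/eqP; rewrite -subr_eq0; apply/eqP; apply: dot_eq0.
set d := v - _; rewrite {1}/d dotBl subr_le0.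
apply: (ge_of_right_limit (diff_quotient_cvg (v := d) dp)) => a /andP[a0 a1].
rewrite ler_pdivlMl//.
by have := H (p + a *: d); rewrite /= -EFinD lee_fin addrAC subrr add0r dotZr -lerBrDl.
Qed.

Lemma smooth_subgradient m phi p : 0 <= m -> strongly_convex m phi ->
  differentiable (phi : 'rV[R]_n -> R^o) p ->
  subgradient (EFin \o phi) p (gradient phi p).
Proof.
move=> m0 sc dp; split=> // y; rewrite /= -EFinD lee_fin.
apply: le_trans (strongly_convex_lower_bound y sc dp).
by rewrite lerDl mulr_ge0 ?dot_ge0// divr_ge0.
Qed.

Lemma eclosed_smooth phi : (forall x, differentiable (phi : 'rV[R]_n -> R^o) x) ->
  eclosed (EFin \o phi).
Proof.
move=> dphi; rewrite /eclosed.
have -> : [set p : 'rV[R]_n * R | ((EFin \o phi) p.1 <= p.2%:E)%E] =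
    (fun p : 'rV[R]_n * R => p.2 - phi p.1) @^-1` [set r : R | 0 <= r].
  by apply/seteqP; split => -[x r] /=; rewrite lee_fin subr_ge0.
apply: preimage_closed; last exact: closed_ge.
move=> [x r] _; apply: cvgB; first exact: cvg_snd.
apply: (@continuous_comp _ _ R^o fst phi (x, r)); first exact: cvg_fst.
exact: differentiable_continuous (dphi x).
Qed.

Lemma econvex_smooth m phi : 0 <= m -> strongly_convex m phi ->
  econvex (EFin \o phi).
Proof.
move=> m0 sc x y a a01; have := strongly_convex_combination x y sc a01.
rewrite /= -!EFinM -EFinD lee_fin => /le_trans; apply.
rewrite lerBlDr lerDl !mulr_ge0 ?dot_ge0//; first by case/andP: a01.
by rewrite subr_ge0; case/andP: a01.
Qed.

Lemma eproper_smooth phi : eproper (EFin \o phi).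
Proof. by split=> //; exists 0. Qed.

Section Argmin.
Variables (m : R) (phi : 'rV[R]_n -> R) (gam : 'rV[R]_n -> \bar R).
Hypotheses (m_gt0 : 0 < m) (sc : strongly_convex m phi).
Hypothesis dphi : forall x, differentiable (phi : 'rV[R]_n -> R^o) x.
Hypotheses (cl_gam : eclosed gam) (cvx_gam : econvex gam) (pr_gam : eproper gam).

Let xmin := argmin (fun x => (phi x)%:E + gam x)%E.

Lemma argmin_subgradient : subgradient gam xmin (- gradient phi xmin).
Proof.
apply: minimizer_subgradient => //.
exact: (@getPex _ (fun x => forall y, ((phi x)%:E + gam x <= (phi y)%:E + gam y)%E)
  (exists_argmin_sum m_gt0 sc dphi cl_gam cvx_gam pr_gam)).
Qed.

(** The optimality condition is also sufficient: monotone subgradients and a strongly monotone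
    gradient leave room for one solution only. *)
Lemma argmin_unique p : subgradient gam p (- gradient phi p) -> xmin = p.
Proof.
move=> /(subgradient_monotone argmin_subgradient).
rewrite -opprD dotNl oppr_ge0 => /(le_trans (strongly_monotone _ _ sc dphi)).
by rewrite pmulr_rle0// => /dot_eq0/eqP; rewrite subr_eq0 => /eqP.
Qed.

End Argmin.

Section Prox.
Variables (rho : R) (gam : 'rV[R]_n -> \bar R).
Hypotheses (rho_gt0 : 0 < rho).
Hypotheses (cl_gam : eclosed gam) (cvx_gam : econvex gam) (pr_gam : eproper gam).

Let pq z := quadratic 0 (rho^-1)%:M z.

Let gradient_pq z y : gradient (pq z) y = rho^-1 *: (y - z).
Proof. by rewrite gradient_quadratic ?tr_scalar_mx// add0r mul_mx_scalar. Qed.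

Let sc_pq z : strongly_convex rho^-1 (pq z).
Proof.
apply: quadratic_strongly_convex; first by rewrite tr_scalar_mx.
by move=> v; rewrite mul_mx_scalar dotZl.
Qed.

Let d_pq z y : differentiable (pq z : 'rV[R]_n -> R^o) y.
Proof. exact: differentiable_quadratic. Qed.

Let proxE z : prox rho gam z = argmin (fun y => (pq z y)%:E + gam y)%E.
Proof.
by congr argmin; apply/funext => y; rewrite prox_term_quadratic addeC.
Qed.

Lemma prox_subgradient z :
  subgradient gam (prox rho gam z) (rho^-1 *: (z - prox rho gam z)).
Proof.
rewrite -[z - _]opprB scalerN -gradient_pq proxE.
by apply: argmin_subgradient (sc_pq z) _ _ _ _ => //; rewrite invr_gt0.
Qed.

Lemma prox_unique z p : subgradient gam p (rho^-1 *: (z - p)) -> prox rho gam z = p.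
Proof.
rewrite -[z - _]opprB scalerN -gradient_pq proxE.
by apply: argmin_unique (sc_pq z) _ _ _ _ _ => //; rewrite invr_gt0.
Qed.

(** Monotonicity of the subgradients [rho^-1 *: (z - prox rho gam z)] at the two proximal points. *)
Lemma prox_firmly_nonexpansive z w :
  dot (prox rho gam z - prox rho gam w) (prox rho gam z - prox rho gam w) <=
  dot (z - w) (prox rho gam z - prox rho gam w).
Proof.
have := subgradient_monotone (prox_subgradient z) (prox_subgradient w).
move: (prox _ _ z) (prox _ _ w) => p q; rewrite -scalerBr dotZl pmulr_rge0 ?invr_gt0//.
by rewrite !dotE; lra.
Qed.

Lemma prox_nonexpansive z w :
  enorm (prox rho gam z - prox rho gam w) <= enorm (z - w).
Proof.
apply: enorm_le_dual; last exact: enorm_ge0.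
exact: le_trans (prox_firmly_nonexpansive z w) (cauchy_schwarz _ _).
Qed.

Lemma reflected_prox_nonexpansive z w :
  enorm (2 *: (prox rho gam z - prox rho gam w) - (z - w)) <= enorm (z - w).
Proof.
rewrite enorm_le; have := prox_firmly_nonexpansive z w.
move: (prox _ _ z - _) (z - w) => d e.
by rewrite !(dotBl, dotBr, dotZl, dotZr) (dotC d e); lra.
Qed.

End Prox.

Section ProxSmooth.
Variables (m rho : R) (phi : 'rV[R]_n -> R).
Hypotheses (m_ge0 : 0 <= m) (sc : strongly_convex m phi) (rho_gt0 : 0 < rho).
Hypothesis dphi : forall x, differentiable (phi : 'rV[R]_n -> R^o) x.

(** Validates the initial [z(0)] of Douglas-Rachford splitting. *)
Lemma prox_smoothK x : prox rho (EFin \o phi) (x + rho *: gradient phi x) = x.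
Proof.
apply: prox_unique => //; first exact: eclosed_smooth.
- exact: econvex_smooth sc.
- exact: eproper_smooth.
- rewrite addrAC subrr add0r scalerA mulVf ?gt_eqF// scale1r.
  exact: smooth_subgradient sc _.
Qed.

Lemma prox_smoothE z : let x := prox rho (EFin \o phi) z in
  z = x + rho *: gradient phi x.
Proof.
move=> x; have := prox_subgradient rho_gt0 (eclosed_smooth dphi)
  (econvex_smooth m_ge0 sc) (eproper_smooth phi) z.
move=> /(subgradient_smooth (dphi _)) <-.
by rewrite scalerA mulfV ?gt_eqF// scale1r addrC subrK.
Qed.

End ProxSmooth.

End Minimizers.

(** * Contraction of both splitting methods towards the minimizer *)

Section Splitting.
Context {R : realType} {n : nat}.
Implicit Types (x y z w p q v : 'rV[R]_n) (rho m L : R).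

Lemma iter_contraction (T : 'rV[R]_n -> 'rV[R]_n) (k : R) p x (J : nat) : 0 <= k ->
  (forall x y, enorm (T x - T y) <= k * enorm (x - y)) -> T p = p ->
  enorm (iter J T x - p) <= k ^+ J * enorm (x - p).
Proof.
move=> k0 kT Tp; elim: J => [|J IH]; first by rewrite expr0 mul1r.
rewrite iterS -{1}Tp exprS -mulrA (le_trans (kT _ _))//.
by rewrite ler_wpM2l.
Qed.

Variables (m L rho : R) (phi : 'rV[R]_n -> R) (gam : 'rV[R]_n -> \bar R).
Hypotheses (m_gt0 : 0 < m) (m_le_L : m <= L).
Hypotheses (sc : strongly_convex m phi) (sm : L_smooth L phi).
Hypotheses (cl_gam : eclosed gam) (cvx_gam : econvex gam) (pr_gam : eproper gam).

Let dphi : forall x, differentiable (phi : 'rV[R]_n -> R^o) x := sm.1.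

Let L_gt0 : 0 < L := lt_le_trans m_gt0 m_le_L.

Let forwardB x y : x - rho *: gradient phi x - (y - rho *: gradient phi y) =
  (x - y) - rho *: (gradient phi x - gradient phi y).
Proof. by apply/rowP => i; rewrite !mxE; ring. Qed.

Let backwardB x y : x + rho *: gradient phi x - (y + rho *: gradient phi y) =
  (x - y) + rho *: (gradient phi x - gradient phi y).
Proof. by apply/rowP => i; rewrite !mxE; ring. Qed.

Lemma zetaFB_ge0 : 0 <= zetaFB m L rho.
Proof. by rewrite le_max normr_ge0. Qed.

Lemma zetaDR_ge0 : 0 < rho -> 0 <= zetaDR m L rho.
Proof.
by move=> rho0; rewrite le_max divr_ge0// addr_ge0// mulr_ge0// ltW.
Qed.

Lemma zeta_ge0 s J : step_size_ok s L rho -> 0 <= zeta s m L rho J.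
Proof.
case: s => /= [_|rho0]; first by rewrite exprn_ge0 ?zetaFB_ge0.
rewrite mulr_ge0 ?exprn_ge0 ?zetaDR_ge0//.
by rewrite divr_ge0// addr_ge0// mulr_ge0// ltW.
Qed.

(** Both contraction factors are at most 1, the forward-backward one by [rho < 2 / L]; moreover
    [(1 + rho * L) / (1 + rho * m) <= L / m]. *)
Lemma zeta_le s J : step_size_ok s L rho -> zeta s m L rho J <= L / m.
Proof.
have Lm1 : 1 <= L / m by rewrite ler_pdivlMr// mul1r.
case: s => /= [/andP[rho0 rhoL]|rho0].
  apply: le_trans Lm1; rewrite exprn_ile1 ?zetaFB_ge0//.
  have h1 : rho * L < 2 by rewrite -ltr_pdivlMr.
  have h2 : rho * m <= rho * L by rewrite ler_pM2l.
  have h3 : 0 < rho * m by rewrite mulr_gt0.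
  by rewrite ge_max !ler_norml; apply/andP; split; apply/andP; split; lra.
have rm := mulr_gt0 rho0 m_gt0; have rL := mulr_gt0 rho0 L_gt0.
have rmL : rho * m <= rho * L by rewrite ler_pM2l.
rewrite -[leRHS]mul1r ler_pM ?exprn_ge0 ?zetaDR_ge0//.
- by rewrite divr_ge0// addr_ge0// ltW.
- rewrite exprn_ile1 ?zetaDR_ge0//.
  by rewrite ge_max !ler_pdivrMr ?addr_gt0// !mul1r; apply/andP; split; lra.
- rewrite ler_pdivrMr ?addr_gt0// mulrAC ler_pdivlMr//.
  by rewrite mulrDl mul1r mulrDr mulr1 mulrCA mulrA lerD2r.
Qed.

Section ForwardBackward.
Hypothesis rho_gt0 : 0 < rho.

Lemma fb_step_contraction x y :
  enorm (fb_step rho phi gam x - fb_step rho phi gam y) <=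
  zetaFB m L rho * enorm (x - y).
Proof.
apply: le_trans (prox_nonexpansive rho_gt0 cl_gam cvx_gam pr_gam _ _) _.
rewrite forwardB; apply: sector_forward => //.
exact: smooth_strongly_convex_sector.
Qed.

Lemma fb_step_fixed p :
  subgradient gam p (- gradient phi p) -> fb_step rho phi gam p = p.
Proof.
move=> sp; apply: prox_unique => //.
by rewrite addrAC subrr add0r scalerN scalerA mulVf ?gt_eqF// scale1r.
Qed.

End ForwardBackward.

Section DouglasRachford.
Hypothesis rho_gt0 : 0 < rho.

Let pphi := prox rho (EFin \o phi).
Let m_ge0 := ltW m_gt0.

Lemma prox_smooth_contraction z w :
  (1 + rho * m) * enorm (pphi z - pphi w) <= enorm (z - w).
Proof.
rewrite {2}(prox_smoothE m_ge0 sc rho_gt0 dphi z) {2}(prox_smoothE m_ge0 sc rho_gt0 dphi w).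
rewrite -/pphi; move: (pphi z) (pphi w) => x y.
have c0 : 0 < 1 + rho * m by rewrite addr_gt0// mulr_gt0.
rewrite -ler_pdivlMl//; apply: enorm_le_dual; last first.
  by rewrite mulr_ge0 ?enorm_ge0// invr_ge0 ltW.
rewrite -mulrA ler_pdivlMl// (le_trans _ (cauchy_schwarz _ _))//.
rewrite backwardB [leRHS]dotDl dotZl mulrDl mul1r lerD2l -mulrA ler_pM2l//.
exact: strongly_monotone.
Qed.

Lemma dr_step_contraction z w :
  enorm (dr_step rho phi gam z - dr_step rho phi gam w) <=
  zetaDR m L rho * enorm (z - w).
Proof.
rewrite /dr_step -/pphi.
have ez := prox_smoothE m_ge0 sc rho_gt0 dphi z.
have ew := prox_smoothE m_ge0 sc rho_gt0 dphi w.
rewrite -/pphi in ez ew; cbv zeta in ez, ew.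
have := smooth_strongly_convex_sector m_le_L sc sm (pphi z) (pphi w).
move: (pphi z) (pphi w) ez ew => x y ez ew /=.
move: (gradient phi x) (gradient phi y) ez ew => u v ez ew.
move=> /(sector_reflected m_gt0 m_le_L rho_gt0).
have <- : z - w = (x - y) + rho *: (u - v).
  by rewrite ez ew; apply/rowP => i; rewrite !mxE; ring.
have <- : 2 *: x - z - (2 *: y - w) = (x - y) - rho *: (u - v).
  by rewrite ez ew; apply/rowP => i; rewrite !mxE; ring.
have := reflected_prox_nonexpansive rho_gt0 cl_gam cvx_gam pr_gam
  (2 *: x - z) (2 *: y - w).
move: (prox rho gam (2 *: x - z)) (prox rho gam (2 *: y - w)) => p q H1 H2.
(* The step averages the identity and the composition of two reflections, of Lipschitz constants
   [2 * zetaDR m L rho - 1] and 1; the average has constant [zetaDR m L rho]. *)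
have -> : z + p - x - (w + q - y) =
    2^-1 *: ((z - w) + (2 *: (p - q) - (2 *: x - z - (2 *: y - w)))).
  by apply/rowP => i; rewrite !mxE; field.
rewrite enormZ ger0_norm ?invr_ge0// ler_pdivrMl//.
by apply: le_trans (enormD _ _) _; lra.
Qed.

Lemma dr_step_fixed p : subgradient gam p (- gradient phi p) ->
  dr_step rho phi gam (p + rho *: gradient phi p) = p + rho *: gradient phi p.
Proof.
move=> sp; rewrite /dr_step (prox_smoothK m_ge0 sc rho_gt0 dphi).
have -> : 2 *: p - (p + rho *: gradient phi p) = p - rho *: gradient phi p.
  by rewrite scaler_nat mulr2n opprD addrA addrK.
by rewrite [prox _ _ _](fb_step_fixed rho_gt0 sp) addrK.
Qed.

End DouglasRachford.

Lemma splitting_steps_contraction s J p x : step_size_ok s L rho ->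
  subgradient gam p (- gradient phi p) ->
  enorm (splitting_steps s rho phi gam J x - p) <= zeta s m L rho J * enorm (x - p).
Proof.
case: s => /= [/andP[rho0 _]|rho0] sp.
  apply: iter_contraction => //; first exact: zetaFB_ge0.
    exact: fb_step_contraction.
  exact: fb_step_fixed.
(* In the Douglas-Rachford case, passing from [x] to [z(0)] costs the factor [1 + rho * L], and the
   final proximal step gains [1 + rho * m]. *)
have c0 : 0 < 1 + rho * m by rewrite addr_gt0// mulr_gt0.
rewrite -{1}(prox_smoothK (ltW m_gt0) sc rho0 dphi p).
rewrite mulrA mulrAC ler_pdivlMr// mulrC.
apply: le_trans (prox_smooth_contraction rho0 _ _) _.
apply: (le_trans (iter_contraction _ _ (zetaDR_ge0 rho0)
  (dr_step_contraction rho0) (dr_step_fixed rho0 sp))).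
rewrite -mulrA ler_wpM2l ?exprn_ge0 ?zetaDR_ge0//.
rewrite backwardB (le_trans (enormD _ _))// mulrDl mul1r lerD2l.
by rewrite enormZ gtr0_norm// -mulrA ler_pM2l// sm.2.
Qed.

(** Adding monotonicity of the subgradients to strong monotonicity of the gradient bounds
    [m * dot (p - q) (p - q)] by [dot (v - gradient phi q) (p - q)]. It serves for the drift of the
    optimum and for the prediction error. *)
Lemma minimizer_perturbation p q v : subgradient gam p (- gradient phi p) ->
  subgradient gam q (- v) -> enorm (p - q) <= m^-1 * enorm (v - gradient phi q).
Proof.
move=> sp sq; apply: enorm_le_dual; last by rewrite mulr_ge0 ?enorm_ge0// invr_ge0 ltW.
rewrite -mulrA ler_pdivlMl// (le_trans _ (cauchy_schwarz _ _))//.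
have := strongly_monotone p q sc dphi.
have := subgradient_monotone sp sq.
by rewrite !dotE; lra.
Qed.

End Splitting.

(** * Affine recursions and their upper limit *)

Section Sequences.
Context {R : realType}.

Lemma affine_recursion (e : nat -> R) (q r : R) : 0 <= q -> q < 1 -> 0 <= r ->
  (forall k, e k.+1 <= q * e k + r) -> forall k, e k <= e 0%N * q ^+ k + r / (1 - q).
Proof.
move=> q0 q1 r0 he; have p : 0 < 1 - q by rewrite subr_gt0.
elim=> [|k IH]; first by rewrite expr0 mulr1 lerDl divr_ge0// ltW.
apply: (le_trans (he k)); apply: (le_trans (lerD (ler_wpM2l q0 IH) (lexx r))).
rewrite mulrDr mulrCA -exprS -addrA lerD2l le_eqVlt; apply/orP; left; apply/eqP.
by field; rewrite gt_eqF.
Qed.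

Lemma limn_esup_affine_recursion (e : nat -> R) (q r : R) :
  0 <= q -> q < 1 -> 0 <= r -> (forall k, e k.+1 <= q * e k + r) ->
  (limn_esup (fun k => (e k)%:E) <= (r / (1 - q))%:E)%E.
Proof.
move=> q0 q1 r0 he; apply/lee_addgt0Pr => d d0.
have qc : (fun k => e 0%N * q ^+ k) @ \oo --> 0.
  by apply: cvg_geometric; rewrite ger0_norm.
have Vd : \forall k \near \oo, e 0%N * q ^+ k < d by exact: (cvgr_lt 0 qc).
(* The upper limit is an infimum of suprema over tails; the tail where the transient is below [d] is
   enough. *)
apply: ge_ereal_inf.
eexists; first by exists [set k | e 0%N * q ^+ k < d]; [exact: Vd | reflexivity].
apply: ge_ereal_sup => _ [k kd <-]; rewrite -EFinD lee_fin.
apply: (le_trans (affine_recursion q0 q1 r0 he k)).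
by rewrite addrC lerD2l ltW.
Qed.

End Sequences.

(* [a], [u], [v], [w], [k], [c], [e] stand for the distances between the iterates,
   the minimizer of the prediction model and the two optima; [l = L / m] and
   [d = C0 Ts / m]. *)
Lemma two_stage_bound {R : realType} (z l d a u v w k c e : R) :
  0 <= z -> z <= l -> 0 <= d -> 0 <= l ->
  a <= u + w -> u <= z * v -> v <= k + w -> k <= e + c -> c <= d ->
  w <= 2 * l * k + 2 * d ->
  a <= (z + (z + 1) * (2 * l)) * e + d * (l + 2 * (l + 1) ^+ 2).
Proof.
move=> z0 zl d0 l0 au uv vk ke cd wk.
have kd : k <= e + d by rewrite (le_trans ke)// lerD2l.
have w_le : w <= 2 * l * (e + d) + 2 * d.
  by rewrite (le_trans wk)// lerD2r ler_wpM2l// mulr_ge0.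
have v_le : z * v <= z * (e + d + w).
  by rewrite ler_wpM2l// (le_trans vk)// lerD2r.
have z1w : (z + 1) * w <= (z + 1) * (2 * l * (e + d) + 2 * d).
  by rewrite ler_wpM2l// addr_ge0.
have zd : d * (z + (z + 1) * (2 * l + 2)) <= d * (l + (l + 1) * (2 * l + 2)).
  by rewrite ler_wpM2l// lerD// ler_wpM2r ?lerD2r// addr_ge0// mulr_ge0.
lra.
Qed.

(** * The prediction model and one period of the algorithm *)

Section PredictionCorrection.
Context {R : realType} {n : nat}.
Implicit Types (x y v w b : 'rV[R]_n) (H : 'M[R]_n).

Section QuadraticModel.
Variables (m L : R) (b : 'rV[R]_n) (H : 'M[R]_n) (x0 : 'rV[R]_n).
Hypothesis L_ge0 : 0 <= L.
Hypothesis H_ge : forall v, m * dot v v <= dot (v *m H) v.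
Hypothesis H_le : forall v w, dot (v *m H) w <= L * enorm v * enorm w.

Let S := 2^-1 *: (H + H^T).

Let trS : S^T = S.
Proof. by rewrite /S linearZ/= linearD/= trmxK addrC. Qed.

Let dotS v w : dot (v *m S) w = 2^-1 * (dot (v *m H) w + dot (w *m H) v).
Proof.
by rewrite /S -scalemxAr mulmxDr dotZl dotDl (dot_mulmx v w H^T) trmxK (dotC v).
Qed.

Lemma quadratic_model_strongly_convex : strongly_convex m (quadratic b H x0).
Proof.
rewrite quadratic_sym; apply: quadratic_strongly_convex => // v.
by rewrite dotS; have := H_ge v; lra.
Qed.

Lemma quadratic_model_L_smooth : L_smooth L (quadratic b H x0).
Proof.
rewrite quadratic_sym; apply: quadratic_L_smooth => // v w.
by rewrite dotS; have := H_le v w; have := H_le w v; lra.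
Qed.

Lemma quadratic_model_gradient y :
  enorm (gradient (quadratic b H x0) y - b) <= L * enorm (y - x0).
Proof.
have g0 : gradient (quadratic b H x0) x0 = b.
  by rewrite quadratic_sym gradient_quadratic// subrr mul0mx addr0.
by have := quadratic_model_L_smooth.2 y x0; rewrite g0.
Qed.

End QuadraticModel.

Variables (m L C0 rho Ts : R) (f : 'rV[R]_n -> R -> R) (g : 'rV[R]_n -> \bar R).
Hypotheses (m_gt0 : 0 < m) (m_le_L : m <= L).
Hypothesis f_regular : regular_cost f.
Hypothesis f_sc : forall tau : R, 0 <= tau -> strongly_convex m (f^~ tau).
Hypothesis f_sm : forall tau : R, 0 <= tau -> L_smooth L (f^~ tau).
Hypotheses (cl_g : eclosed g) (cvx_g : econvex g) (pr_g : eproper g).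
Hypothesis dt_le : forall x (tau : R), 0 <= tau -> enorm (dt_gradient f x tau) <= C0.
Hypothesis Ts_gt0 : 0 < Ts.

Let L_gt0 : 0 < L := lt_le_trans m_gt0 m_le_L.

Let xopt tau := argmin (fun x => (f x tau)%:E + g x)%E.

Let xopt_subgradient tau : 0 <= tau ->
  subgradient g (xopt tau) (- gradient (f^~ tau) (xopt tau)).
Proof.
by move=> tau0; apply: argmin_subgradient (f_sc tau0) (f_sm tau0).1 _ _ _.
Qed.

Lemma optimal_drift tau : 0 <= tau ->
  enorm (xopt (tau + Ts) - xopt tau) <= C0 * Ts / m.
Proof.
move=> tau0; have tau1 : 0 <= tau + Ts by rewrite addr_ge0// ltW.
apply: le_trans (minimizer_perturbation m_gt0 (f_sc tau1) (f_sm tau1)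
  (xopt_subgradient tau1) (xopt_subgradient tau0)) _.
rewrite mulrC ler_wpM2r ?invr_ge0 ?(ltW m_gt0)// enormB.
have lt : tau <= tau + Ts by rewrite lerDl ltW.
have := gradient_time_lipschitz f_regular (dt_le (xopt tau)) tau0 lt.
by rewrite [tau + Ts - tau]addrAC subrr add0r.
Qed.

Section Model.
Variables (tau : R) (xk : 'rV[R]_n).
Hypothesis tau_ge0 : 0 <= tau.

Let h := prediction_model f Ts tau xk.

Let df : differentiable (gradient (f^~ tau)) xk.
Proof. by case: f_regular => -[_ + _] _; apply. Qed.

Let hess_ge v : m * dot v v <= dot (v *m hessian (f^~ tau) xk) v.
Proof. by apply: hessian_ge; [exact: f_sc | exact: (f_sm tau_ge0).1 | exact: df]. Qed.

Let hess_le v w :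
  dot (v *m hessian (f^~ tau) xk) w <= L * enorm v * enorm w.
Proof. by apply: hessian_le; [exact: f_sm | exact: df]. Qed.

Lemma prediction_model_strongly_convex : strongly_convex m h.
Proof. exact: quadratic_model_strongly_convex. Qed.

Lemma prediction_model_L_smooth : L_smooth L h.
Proof. by apply: quadratic_model_L_smooth => //; exact: ltW. Qed.

Let xpred := argmin (fun x => (h x)%:E + g x)%E.

Lemma xpred_subgradient : subgradient g xpred (- gradient h xpred).
Proof.
by apply: argmin_subgradient prediction_model_strongly_convex
  prediction_model_L_smooth.1 _ _ _.
Qed.

Lemma prediction_error : enorm (xpred - xopt (tau + Ts)) <=
  2 * L / m * enorm (xk - xopt (tau + Ts)) + 2 * (C0 * Ts / m).
Proof.
have tau1 : 0 <= tau + Ts by rewrite addr_ge0// ltW.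
have := minimizer_perturbation m_gt0 prediction_model_strongly_convex
  prediction_model_L_smooth xpred_subgradient (xopt_subgradient tau1).
move=> /le_trans; apply.
set q := xopt _; set G := gradient (f^~ (tau + Ts)) q.
pose b := gradient (f^~ tau) xk + Ts *: dt_gradient f xk tau.
have h1 : enorm (G - gradient (f^~ tau) q) <= C0 * Ts.
  have lt : tau <= tau + Ts by rewrite lerDl ltW.
  have := gradient_time_lipschitz f_regular (dt_le q) tau_ge0 lt.
  by rewrite [tau + Ts - tau]addrAC subrr add0r.
have h2 := (f_sm tau_ge0).2 q xk.
have h3 : enorm (gradient h q - b) <= L * enorm (q - xk).
  by apply: quadratic_model_gradient => //; exact: ltW.
have h4 : enorm (Ts *: dt_gradient f xk tau) <= C0 * Ts.
  by rewrite enormZ gtr0_norm// mulrC ler_wpM2r ?(ltW Ts_gt0) ?dt_le.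
(* The change in time and the term in [Ts] cost [C0 * Ts] each; the change in space and the linear
   part of the model cost [L * enorm (q - xk)] each. Hence both factors 2. *)
have -> : G - gradient h q = (G - gradient (f^~ tau) q) +
    (gradient (f^~ tau) q - gradient (f^~ tau) xk) +
    (- (gradient h q - b)) + (- (Ts *: dt_gradient f xk tau)).
  rewrite /b; move: (G) (gradient _ _) (gradient _ _) (gradient _ _) (Ts *: _).
  by move=> a1 a2 a3 a4 a5; apply/rowP => i; rewrite !mxE; ring.
have := enormD (G - gradient (f^~ tau) q + (gradient (f^~ tau) q - gradient (f^~ tau) xk)
  + (- (gradient h q - b))) (- (Ts *: dt_gradient f xk tau)).
have := enormD (G - gradient (f^~ tau) q + (gradient (f^~ tau) q - gradient (f^~ tau) xk))
  (- (gradient h q - b)).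
have := enormD (G - gradient (f^~ tau) q) (gradient (f^~ tau) q - gradient (f^~ tau) xk).
rewrite !enormN (enormB xk) => t1 t2 t3.
rewrite [leRHS](_ : _ = m^-1 * (C0 * Ts + L * enorm (q - xk) + L * enorm (q - xk) + C0 * Ts)).
  rewrite ler_wpM2l ?invr_ge0 ?(ltW m_gt0)//; apply: (le_trans t3).
  rewrite lerD//; apply: (le_trans t2); rewrite lerD//; apply: (le_trans t1).
  by rewrite lerD.
by field; rewrite gt_eqF.
Qed.

End Model.

Lemma prediction_correction_step s P C tau xk :
  step_size_ok s L rho -> 0 <= tau ->
  let zP := zeta s m L rho P in let zC := zeta s m L rho C in
  enorm (splitting_steps s rho (f^~ (tau + Ts)) g C
           (splitting_steps s rho (prediction_model f Ts tau xk) g P xk)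
         - xopt (tau + Ts)) <=
  zC * (zP + (zP + 1) * (2 * L / m)) * enorm (xk - xopt tau) +
  zC * (C0 * Ts / m) * (L / m + 2 * (L / m + 1) ^+ 2).
Proof.
move=> ok tau0; have tau1 : 0 <= tau + Ts by rewrite addr_ge0// ltW.
set xp := splitting_steps _ _ _ _ P _.
have hC := splitting_steps_contraction m_gt0 m_le_L (f_sc tau1) (f_sm tau1)
  cl_g cvx_g pr_g C xp ok (xopt_subgradient tau1).
have hP := splitting_steps_contraction m_gt0 m_le_L
  (prediction_model_strongly_convex xk tau0) (prediction_model_L_smooth xk tau0)
  cl_g cvx_g pr_g P xk ok (xpred_subgradient xk tau0).
have := prediction_error xk tau0.
move: hP; rewrite -/xp; set ph := argmin _ => hP hE.
have hD := optimal_drift tau0.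
have zC0 : 0 <= zeta s m L rho C by exact: zeta_ge0.
have zP0 : 0 <= zeta s m L rho P by exact: zeta_ge0.
have zPL : zeta s m L rho P <= L / m by exact: zeta_le.
(* Detours through the minimizer [ph] of the model and through the two successive optima. *)
have t1 := enorm_sub3 xp ph (xopt (tau + Ts)).
have t2 := enorm_sub3 xk (xopt (tau + Ts)) ph.
have t3 := enorm_sub3 xk (xopt tau) (xopt (tau + Ts)).
move: t2 t3; rewrite (enormB (xopt tau)) (enormB (xopt (tau + Ts)) ph) => t2 t3.
apply: (le_trans hC).
have d0 : 0 <= C0 * Ts / m by exact: le_trans (enorm_ge0 _) hD.
have l0 : 0 <= L / m by rewrite divr_ge0 ?(ltW L_gt0) ?(ltW m_gt0).
have eL : 2 * L / m = 2 * (L / m) by rewrite mulrA.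
rewrite eL in hE; rewrite eL.
rewrite -[_ * enorm (xk - xopt tau)]mulrA -[_ * (L / m + _)]mulrA -mulrDr ler_wpM2l//.
exact: (two_stage_bound zP0 zPL d0 l0 t1 hP t2 t3 hD hE).
Qed.

End PredictionCorrection.

Theorem theorem1 (R : realType) (m L C0 eta : R)
    (m_gt0 : 0 < m) (m_le_L : m <= L) (eta_lt1 : eta < 1) :
  exists2 K : R, 0 <= K &
  forall (n : nat) (f : 'rV[R]_n -> R -> R) (g : 'rV[R]_n -> \bar R)
         (s : splitting) (rho Ts : R) (P C : nat) (t : nat -> R)
         (x0 : 'rV[R]_n),
    regular_cost f ->
    (forall tau : R, 0 <= tau -> strongly_convex m (f^~ tau)) ->
    (forall tau : R, 0 <= tau -> L_smooth L (f^~ tau)) ->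
    eclosed g -> econvex g -> eproper g ->
    (forall (x : 'rV[R]_n) (tau : R), 0 <= tau -> enorm (dt_gradient f x tau) <= C0) ->
    0 < Ts ->
    0 <= t 0%N ->
    (forall k, t k.+1 - t k = Ts) ->
    step_size_ok s L rho ->
    eta = zeta s m L rho C *
            (zeta s m L rho P + (zeta s m L rho P + 1) * (2 * L / m)) ->
    let x := pc_sequence s rho P C f g Ts t x0 in
    let xstar := optimal_trajectory f g t in
    Qlinear_to_neighborhood x xstar /\
    (limn_esup (fun k => (enorm (x k - xstar k))%:E)
       <= (K * zeta s m L rho C * Ts)%:E)%E.
Proof.
have L_gt0 : 0 < L := lt_le_trans m_gt0 m_le_L.
have l0 : 0 <= L / m by rewrite divr_ge0 ?(ltW L_gt0) ?(ltW m_gt0).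
have A0 : 0 <= L / m + 2 * (L / m + 1) ^+ 2.
  by rewrite addr_ge0// mulr_ge0// sqr_ge0.
have eta0 : 0 < 1 - eta by rewrite subr_gt0.
(* This is [r / (1 - eta)] with [zeta s m L rho C * Ts] factored out. The absolute value is there
   because the sign of [C0] is known only once [f] is given. *)
exists (`|C0| / m * (L / m + 2 * (L / m + 1) ^+ 2) / (1 - eta)).
  by rewrite divr_ge0 ?(ltW eta0)// mulr_ge0// divr_ge0 ?(ltW m_gt0).
move=> n f g s rho Ts P C t x0 fr fsc fsm clg cvxg prg dt Ts0 t0 tS ok etaE x xstar.
have C00 : 0 <= C0 := le_trans (enorm_ge0 _) (dt 0 _ t0).
have tk k : 0 <= t k.
  by elim: k => // k IH; rewrite -(subrK (t k) (t k.+1)) tS addr_ge0// ltW.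
have zP0 := zeta_ge0 m_gt0 m_le_L P ok.
have zC0 := zeta_ge0 m_gt0 m_le_L C ok.
have eta_ge0 : 0 <= eta.
  by rewrite etaE mulr_ge0// addr_ge0// mulr_ge0 ?addr_ge0// -mulrA mulr_ge0.
pose r := zeta s m L rho C * (C0 * Ts / m) * (L / m + 2 * (L / m + 1) ^+ 2).
have r0 : 0 <= r.
  by rewrite !mulr_ge0 ?invr_ge0 ?(ltW m_gt0) ?(ltW Ts0).
have step k : enorm (x k.+1 - xstar k.+1) <= eta * enorm (x k - xstar k) + r.
  have e : t k.+1 = t k + Ts by rewrite -(tS k) addrC subrK.
  rewrite etaE /x /xstar /optimal_trajectory /= e.
  exact: prediction_correction_step.
split; first by exists eta, r.
have := limn_esup_affine_recursion eta_ge0 eta_lt1 r0 step.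
rewrite (_ : r / (1 - eta) = `|C0| / m * (L / m + 2 * (L / m + 1) ^+ 2) / (1 - eta) *
  zeta s m L rho C * Ts)//.
rewrite ger0_norm// /r; move: (zeta _ _ _ _ _) => z.
by field; rewrite !gt_eqF.
Qed.
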